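(* Suppose that a group $G$ is finitely presented with respect to a collection of subgroups $\{H_\lambda\}_{\lambda\in\Lambda}$ and that the relative Dehn function of $G$ with respect to $\{H_\lambda\}_{\lambda\in\Lambda}$ is well-defined. Let $X$ be a finite relative generating set of $G$ with respect to $\{H_\lambda\}_{\lambda\in\Lambda}$. Then the following conditions are equivalent. 1) The group $G$ is hyperbolic relative to $\{H_\lambda\}_{\lambda\in\Lambda}$. 2) The Cayley graph $\Gamma(G,X\cup\mathcal H)$ is a hyperbolic metric space.
   Context: A subset $X\subseteq G$ is a relative generating set of $G$ with respect to $\{H_\lambda\}_{\lambda\in\Lambda}$ if $G$ is generated by $X\cup\bigcup_{\lambda\in\Lambda}H_\lambda$. In this case put $F=(\ast_{\lambda\in\Lambda}\widetilde H_\lambda)\ast F(X)$, where $\widetilde H_\lambda$ is an isomorphic copy of $H_\lambda$ and $F(X)$ is the free group with basis $X$, let $\varepsilon:F\to G$ be the canonical epimorphism, and let $\mathcal H=\bigsqcup_{\lambda\in\Lambda}(\widetilde H_\lambda\setminus\{1\})$. $G$ has the relative presentation $\langle X, H_\lambda,\lambda\in\Lambda \mid R=1, R\in\mathcal R\rangle$, where $\mathcal R$ is a set of words over $X^{\pm1}\cup\mathcal H$ (viewed as elements of $F$, closed under cyclic shifts and inverses), if $\ker\varepsilon$ is the normal closure of $\mathcal R$ in $F$. The relative presentation is finite if both $X$ and $\mathcal R$ are finite. $G$ is finitely presented with respect to $\{H_\lambda\}$ if it admits a finite relative presentation. Given a finite relative presentation, $f:\mathbb N\to\mathbb N$ is a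 relative isoperimetric function of it if for every $n$ and every word $W$ over $X^{\pm1}\cup\mathcal H$ of length at most $n$ representing $1$ in $G$, there is an equality $W=\prod_{i=1}^k f_i^{-1}R_if_i$ in $F$ with $R_i\in\mathcal R$, $f_i\in F$, $k\le f(n)$. The smallest such function is the relative Dehn function of $G$ with respect to $\{H_\lambda\}$; it is well-defined if it is finite at every $n$, and linear if it is bounded from above by $Ln$ for some constant $L$ (these properties do not depend on the finite relative presentation). $G$ is hyperbolic relative to $\{H_\lambda\}_{\lambda\in\Lambda}$ if $G$ is finitely presented with respect to $\{H_\lambda\}$ and the relative Dehn function is linear. $\Gamma(G,X\cup\mathcal H)$ denotes the Cayley graph of $G$ with respect to the generating set $X\cup\bigcup_\lambda H_\lambda$ (with letters from $\mathcal H$ as labels), with every edge of length $1$. A geodesic metric space is hyperbolic if there is $\delta\ge0$ such that each side of any geodesic triangle lies in the union of the closed $\delta$-neighborhoods of the other two sides. *)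

(* Defs.v *)
From HB Require Import structures.
From mathcomp Require Import all_boot all_order all_algebra.
From mathcomp Require Import generic_quotient.
From mathcomp Require Import all_classical all_reals all_analysis.
From mathcomp Require Import lra.

Set Implicit Arguments.
Unset Strict Implicit.
Unset Printing Implicit Defensive.

Import Order.TTheory GRing.Theory Num.Theory.

Local Open Scope classical_set_scope.
Local Open Scope quotient_scope.

(* Subgroups are [groupClosed G], i.e. boolean predicates containing 1 and
   closed under multiplication and inversion; classically this is no
   restriction on the subgroups considered. *)

Section subgroups.
Context {G : groupType}.
Local Open Scope group_scope.

Definition generated_subgroup (A : set G) : set G :=
  [set g | forall K : groupClosed G, {in A, forall a, a \in K} -> g \in K].

Definition normal_subgroup (K : groupClosed G) : Prop :=
  forall k g : G, k \in K -> k ^ g \in K.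

Definition normal_closure (A : set G) : set G :=
  [set g | forall K : groupClosed G,
     normal_subgroup K -> {in A, forall a, a \in K} -> g \in K].

Definition kernel {G' : groupType} (f : G -> G') : set G := [set g | f g = 1].

(* A subset given by a [Prop]-valued predicate, packed as a [groupClosed]. *)
Lemma set_groupClosed (A : set G) : A 1 ->
  (forall x y, A x -> A y -> A (x * y)) -> (forall x, A x -> A x^-1) ->
  exists K : groupClosed G, forall x, (x \in K) = (x \in A).
Proof.
move=> A1 AM AV; pose S : {pred G} := fun x => `[< A x >].
have S1 : 1 \in S by apply/asboolP.
have SM x y : x \in S -> y \in S -> x * y \in S.
  by move=> /asboolP xA /asboolP yA; apply/asboolP/AM.
have SV x : x \in S -> x^-1 \in S by move=> /asboolP xA; apply/asboolP/AV.
pose i1 := isMul1Closed.Build G S S1.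
pose i2 := isMulClosed.Build G S SM.
pose i3 := isInvClosed.Build G S SV.
exists (HB.pack_for (groupClosed G) S i1 i2 i3) => x.
by [].
Qed.

End subgroups.

Section words.
Context {G : groupType} {L : Type}.
Variables (X : set G) (H : L -> groupClosed G).
Local Open Scope group_scope.

Definition rel_generating : Prop :=
  generated_subgroup (X `|` \bigcup_(l in setT) [set h | h \in H l]) = setT.

Definition nontrivial (l : L) : Type := {h : G | (h \in H l) && (h != 1)}.

(* The alphabet $X^{\pm1}\cup\mathcal H$, the second part being the disjoint
   union of the [H l] minus 1; [Gen x true] is the letter x and [Gen x false]
   the letter x^-1. *)
Inductive letter : Type :=
  | Gen of set_type X & bool
  | Par l of nontrivial l.

HB.instance Definition _ := gen_eqMixin letter.
HB.instance Definition _ := gen_choiceMixin letter.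

Definition word : Type := seq letter.

Lemma par_inv_subproof l (h : nontrivial l) :
  ((val h)^-1 \in H l) && ((val h)^-1 != 1).
Proof. by rewrite gpredV invg_eq1; exact: (valP h). Qed.

Definition letter_inv (a : letter) : letter :=
  match a with
  | Gen x b => Gen x (~~ b)
  | Par l h => Par (exist _ (val h)^-1 (par_inv_subproof h) : nontrivial l)
  end.

Definition word_inv (w : word) : word := rev (map letter_inv w).

Definition letter_eval (a : letter) : G :=
  match a with
  | Gen x b => if b then val x else (val x)^-1
  | Par l h => val h
  end.

Definition word_eval (w : word) : G := \prod_(a <- w) letter_eval a.

(* The free product of the [H l] and of the free group on X is the group of
   words modulo the congruence generated by [word_rule]. *)
Inductive word_rule : word -> word -> Prop :=
  | rule_gen x b : word_rule [:: Gen x b; Gen x (~~ b)] [::]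
  | rule_par1 l (h k : nontrivial l) : val h * val k = 1 ->
      word_rule [:: @Par l h; @Par l k] [::]
  | rule_parM l (h k m : nontrivial l) : val h * val k = val m ->
      word_rule [:: @Par l h; @Par l k]
                [:: @Par l m].

Inductive word_equiv : word -> word -> Prop :=
  | word_equiv_refl w : word_equiv w w
  | word_equiv_sym u v : word_equiv u v -> word_equiv v u
  | word_equiv_trans u v w :
      word_equiv u v -> word_equiv v w -> word_equiv u w
  | word_equiv_rule u v r s :
      word_rule r s -> word_equiv (u ++ r ++ v) (u ++ s ++ v).

Definition word_equivb (u v : word) : bool := `[< word_equiv u v >].

Lemma word_equivb_is_equiv : equiv_class_of word_equivb.
Proof.
split=> [u|u v|v u w].
- by apply/asboolP; exact: word_equiv_refl.
- by apply/asboolP/asboolP; exact: word_equiv_sym.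
- move=> /asboolP uv /asboolP vw; apply/asboolP.
  exact: word_equiv_trans uv vw.
Qed.

Canonical word_equiv_rel := EquivRelPack word_equivb_is_equiv.

Definition free_prod : Type := {eq_quot word_equiv_rel}.
HB.instance Definition _ := Choice.on free_prod.
HB.instance Definition _ := EqQuotient.on free_prod.

Definition of_word (w : word) : free_prod := \pi_free_prod w.

Lemma of_wordP u v : of_word u = of_word v <-> word_equiv u v.
Proof. by split=> [/eqmodP/asboolP|uv]//; apply/eqmodP/asboolP. Qed.

Lemma of_word_surj (f : free_prod) : exists w, f = of_word w.
Proof. by exists (repr f); rewrite /of_word reprK. Qed.

Lemma word_equiv_ctx a b u v :
  word_equiv u v -> word_equiv (a ++ u ++ b) (a ++ v ++ b).
Proof.
elim=> [w|u' v' _ IH|u' v' w _ IH1 _ IH2|u' v' r s rs].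
- exact: word_equiv_refl.
- exact: word_equiv_sym.
- exact: word_equiv_trans IH1 IH2.
- have -> t : a ++ (u' ++ t ++ v') ++ b = (a ++ u') ++ t ++ (v' ++ b).
    by rewrite !catA.
  have -> : a ++ (u' ++ s ++ v') ++ b = (a ++ u') ++ s ++ (v' ++ b).
    by rewrite !catA.
  exact: word_equiv_rule.
Qed.

Lemma word_equiv_cat u u' v v' :
  word_equiv u u' -> word_equiv v v' -> word_equiv (u ++ v) (u' ++ v').
Proof.
move=> uu' vv'; apply: (@word_equiv_trans _ (u' ++ v)).
  exact: (@word_equiv_ctx [::] v).
by have := @word_equiv_ctx u' [::] _ _ vv'; rewrite !cats0.
Qed.

Lemma letter_invK : involutive letter_inv.
Proof.
case=> [x b|l h] /=; first by rewrite negbK.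
by congr Par; apply: val_inj; rewrite /= invgK.
Qed.

Lemma word_invK : involutive word_inv.
Proof.
by move=> w; rewrite /word_inv map_rev revK -map_comp map_id_in// => a _ /=;
  rewrite letter_invK.
Qed.

Lemma word_inv_cat u v : word_inv (u ++ v) = word_inv v ++ word_inv u.
Proof. by rewrite /word_inv map_cat rev_cat. Qed.

Lemma word_equiv_letterV a : word_equiv [:: a; letter_inv a] [::].
Proof.
apply: (@word_equiv_rule [::] [::] [:: a; letter_inv a] [::]).
case: a => [x b|l h] /=; first exact: rule_gen.
by apply: rule_par1; rewrite /= mulgV.
Qed.

Lemma word_equiv_mulV w : word_equiv (w ++ word_inv w) [::].
Proof.
elim: w => [|a w IH]; first exact: word_equiv_refl.
rewrite -cat1s word_inv_cat.
have -> : ([:: a] ++ w) ++ word_inv w ++ word_inv [:: a] =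
          [:: a] ++ (w ++ word_inv w) ++ [:: letter_inv a].
  by rewrite !catA.
apply: word_equiv_trans (word_equiv_letterV a).
exact: (@word_equiv_ctx [:: a] [:: letter_inv a] _ [::]).
Qed.

Lemma word_equiv_mulVw w : word_equiv (word_inv w ++ w) [::].
Proof. by have := word_equiv_mulV (word_inv w); rewrite word_invK. Qed.

Lemma word_equiv_inv u v :
  word_equiv u v -> word_equiv (word_inv u) (word_inv v).
Proof.
move=> uv.
apply: (@word_equiv_trans _ (word_inv u ++ v ++ word_inv v)).
  rewrite -[X in word_equiv X _]cats0; apply: word_equiv_cat.
    exact: word_equiv_refl.
  exact/word_equiv_sym/word_equiv_mulV.
rewrite -[X in word_equiv _ X]cat0s catA; apply: word_equiv_cat.
  apply: word_equiv_trans (word_equiv_mulVw u).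
  by apply: word_equiv_cat; [exact: word_equiv_refl|exact: word_equiv_sym].
exact: word_equiv_refl.
Qed.

Lemma word_equiv_repr w : word_equiv (repr (of_word w)) w.
Proof. by apply/of_wordP; rewrite {1}/of_word reprK. Qed.

Definition free_mul (f g : free_prod) : free_prod :=
  of_word (repr f ++ repr g).
Definition free_one : free_prod := of_word [::].
Definition free_inv (f : free_prod) : free_prod := of_word (word_inv (repr f)).

Lemma free_mulE u v : free_mul (of_word u) (of_word v) = of_word (u ++ v).
Proof. by apply/of_wordP/word_equiv_cat; exact: word_equiv_repr. Qed.

Lemma free_invE u : free_inv (of_word u) = of_word (word_inv u).
Proof. exact/of_wordP/word_equiv_inv/word_equiv_repr. Qed.

Lemma free_mulA : associative free_mul.
Proof.
move=> f g h; have [u ->] := of_word_surj f; have [v ->] := of_word_surj g.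
by have [w ->] := of_word_surj h; rewrite !free_mulE catA.
Qed.

Lemma free_mul1 : left_id free_one free_mul.
Proof. by move=> f; have [u ->] := of_word_surj f; rewrite free_mulE. Qed.

Lemma free_mulr1 : right_id free_one free_mul.
Proof.
by move=> f; have [u ->] := of_word_surj f; rewrite free_mulE cats0.
Qed.

Lemma free_mulV : left_inverse free_one free_inv free_mul.
Proof.
move=> f; have [u ->] := of_word_surj f; rewrite free_invE free_mulE.
exact/of_wordP/word_equiv_mulVw.
Qed.

Lemma free_mulrV : right_inverse free_one free_inv free_mul.
Proof.
move=> f; have [u ->] := of_word_surj f; rewrite free_invE free_mulE.
exact/of_wordP/word_equiv_mulV.
Qed.

HB.instance Definition _ := isGroup.Build free_prod
  free_mulA free_mul1 free_mulr1 free_mulV free_mulrV.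

Lemma of_word_cat u v : of_word (u ++ v) = of_word u * of_word v.
Proof. by rewrite -free_mulE. Qed.

Lemma of_word_nil : of_word [::] = 1.
Proof. by []. Qed.

Lemma of_word_inv u : of_word (word_inv u) = (of_word u)^-1.
Proof. by rewrite -free_invE. Qed.

Definition free_eps (f : free_prod) : G := word_eval (repr f).

Lemma word_eval_equiv u v : word_equiv u v -> word_eval u = word_eval v.
Proof.
elim=> [//|//|u' v' w _ -> _ ->//|u' v' r s rs].
rewrite /word_eval !big_cat /=; congr (_ * (_ * _)).
case: rs => [x b|l h k hk|l h k m hk]; rewrite ?big_cons big_nil ?mulg1 /=.
- by case: b => /=; rewrite ?mulgV ?mulVg.
- exact: hk.
- exact: hk.
Qed.

Lemma free_epsE w : free_eps (of_word w) = word_eval w.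
Proof. exact/word_eval_equiv/word_equiv_repr. Qed.

Lemma free_epsM : {morph free_eps : f g / f * g}.
Proof.
move=> f g; have [u ->] := of_word_surj f; have [v ->] := of_word_surj g.
by rewrite -of_word_cat !free_epsE /word_eval big_cat.
Qed.

Definition free_gen (x : set_type X) : free_prod := of_word [:: Gen x true].

Definition free_par (l : L) (h : G) : free_prod :=
  of_word (if insub h is Some h' then [:: @Par l h'] else [::]).

(* Universal property of the free product of the [H l] and of the free group
   on X. *)
Lemma free_prod_universal (K : groupType) (psi : set_type X -> K)
    (phi : L -> G -> K) :
  (forall l, {in H l &, {morph phi l : x y / x * y}}) ->
  exists f : free_prod -> K,
    [/\ {morph f : a b / a * b},
        forall x, f (free_gen x) = psi x,
        forall l, {in H l, forall h, f (free_par l h) = phi l h} &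
        forall f' : free_prod -> K,
          {morph f' : a b / a * b} ->
          (forall x, f' (free_gen x) = psi x) ->
          (forall l, {in H l, forall h, f' (free_par l h) = phi l h}) ->
          f' =1 f].
Proof.
move=> phiM.
pose le (a : letter) : K := match a with
  | Gen x b => if b then psi x else (psi x)^-1
  | Par l h => phi l (val h) end.
pose we (w : word) := \prod_(a <- w) le a.
have phi1 l : phi l 1 = 1.
  have := phiM l 1 1 gpred1 gpred1; rewrite mulg1 => e.
  by apply: (@mulgI _ (phi l 1)); rewrite mulg1 -e.
have inH l (h : nontrivial l) : val h \in H l.
  by have /andP[] := valP h.
have weP u v : word_equiv u v -> we u = we v.
  elim=> [//|//|u' v' w _ -> _ ->//|u' v' r s rs].
  rewrite /we !big_cat /=; congr (_ * (_ * _)).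
  case: rs => [x b|l h k hk|l h k m hk]; rewrite ?big_cons big_nil ?mulg1 /=.
  - by case: b => /=; rewrite ?mulgV ?mulVg.
  - by rewrite -phiM ?inH// hk phi1.
  - by rewrite -phiM ?inH// hk.
have fE w : we (repr (of_word w)) = we w by exact/weP/word_equiv_repr.
have we_cat u v : we (u ++ v) = we u * we v by rewrite /we big_cat.
exists (fun f => we (repr f)); split.
- move=> f g; have [u ->] := of_word_surj f; have [v ->] := of_word_surj g.
  by rewrite -of_word_cat !fE we_cat.
- by move=> x; rewrite fE /we big_seq1.
- move=> l h hH; rewrite fE; case: insubP => [h' _ h'E|].
    by rewrite /we big_seq1 /= h'E.
  by rewrite hH /= negbK => /eqP ->; rewrite /we big_nil phi1.
- move=> f' f'M f'X f'H f; have [w ->] := of_word_surj f; rewrite fE.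
  have f'1 : f' 1 = 1.
    have := f'M 1 1; rewrite mulg1 => e.
    by apply: (@mulgI _ (f' 1)); rewrite mulg1 -e.
  have f'V a : f' a^-1 = (f' a)^-1.
    by apply: (@mulgI _ (f' a)); rewrite -f'M !mulgV.
  elim: w => [|a w IH]; first by rewrite /we big_nil -f'1.
  rewrite -cat1s of_word_cat f'M IH we_cat; congr (_ * _).
  rewrite /we big_seq1; case: a => [x [|]|l h] /=.
  + exact: f'X.
  + by rewrite -[_ [:: _]]/(of_word (word_inv [:: Gen x true])) of_word_inv
      f'V f'X.
  + rewrite -f'H ?inH// /free_par; congr (f' (of_word _)).
    by rewrite valK.
Qed.

Definition symmetrized (Rel : set word) : Prop :=
  (forall w i, Rel w -> Rel (rot i w)) /\ (forall w, Rel w -> Rel (word_inv w)).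

Definition rel_presentation (Rel : set word) : Prop :=
  [/\ rel_generating, symmetrized Rel &
      kernel free_eps = normal_closure (of_word @` Rel)].

Definition finite_rel_presentation (Rel : set word) : Prop :=
  [/\ finite_set X, finite_set Rel & rel_presentation Rel].

Definition rel_isoperimetric (Rel : set word) (f : nat -> nat) : Prop :=
  forall (n : nat) (w : word), size w <= n -> word_eval w = 1 ->
  exists (k : nat) (c : 'I_k -> free_prod) (r : 'I_k -> word),
    [/\ k <= f n, forall i, Rel (r i) &
        of_word w = \prod_(i < k) ((c i)^-1 * of_word (r i) * c i)].

Definition is_rel_dehn (Rel : set word) (f : nat -> nat) : Prop :=
  rel_isoperimetric Rel f /\
  forall g, rel_isoperimetric Rel g -> forall n, f n <= g n.

End words.

Section relative_hyperbolicity.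
Context {G : groupType} {L : Type}.
Variable H : L -> groupClosed G.

Definition rel_finitely_presented : Prop :=
  exists (X : set G) (Rel : set (word X H)), finite_rel_presentation Rel.

(* Neither of the next two properties depends on the finite relative
   presentation, so that it is enough to ask for one. *)
Definition rel_dehn_well_defined : Prop :=
  exists (X : set G) (Rel : set (word X H)),
    finite_rel_presentation Rel /\ exists f, is_rel_dehn Rel f.

Definition rel_dehn_linear : Prop :=
  exists (X : set G) (Rel : set (word X H)),
    finite_rel_presentation Rel /\
    exists2 f, is_rel_dehn Rel f & exists C : nat, forall n, f n <= C * n.

Definition rel_hyperbolic : Prop := rel_finitely_presented /\ rel_dehn_linear.

End relative_hyperbolicity.

(* Graphs, with loops and multiple edges allowed; [walk n u v] traverses n
   edges, each one in either direction. *)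
Section walks.
Variables (V E : Type) (src tgt : E -> V).

Inductive walk : nat -> V -> V -> Prop :=
  | walk0 u : walk 0 u u
  | walkf n e v : walk n (tgt e) v -> walk n.+1 (src e) v
  | walkb n e v : walk n (src e) v -> walk n.+1 (tgt e) v.

Lemma walk_cat n m u v w : walk n u v -> walk m v w -> walk (n + m) u w.
Proof.
elim=> [//|{}n e {}v _ IH /IH|{}n e {}v _ IH /IH]; rewrite addSn.
  exact: walkf.
exact: walkb.
Qed.

Lemma walk_edge e : walk 1 (src e) (tgt e).
Proof. exact/walkf/walk0. Qed.

Lemma walk_sym n u v : walk n u v -> walk n v u.
Proof.
elim=> [w|{}n e {}v _ IH|{}n e {}v _ IH]; first exact: walk0.
- by rewrite -addn1; apply: walk_cat IH _; exact/walkb/walk0.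
- by rewrite -addn1; apply: walk_cat IH _; exact/walkf/walk0.
Qed.

End walks.

Record connected_graph := ConnectedGraph {
  vertex : Type;
  edge : Type;
  src : edge -> vertex;
  tgt : edge -> vertex;
  graph_connected : forall u v, exists n, walk src tgt n u v }.

Section graph_distance.
Variable D : connected_graph.

Lemma graph_dist_subproof (u v : vertex D) :
  exists n, `[< walk (@src D) (@tgt D) n u v >].
Proof. by have [n uv] := graph_connected u v; exists n; apply/asboolP. Qed.

Definition graph_dist (u v : vertex D) : nat := ex_minn (graph_dist_subproof u v).

Lemma graph_dist_walk u v :
  walk (@src D) (@tgt D) (graph_dist u v) u v.
Proof. by rewrite /graph_dist; case: ex_minnP => n /asboolP. Qed.

Lemma graph_dist_le u v n :
  walk (@src D) (@tgt D) n u v -> graph_dist u v <= n.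
Proof.
by move=> uv; rewrite /graph_dist; case: ex_minnP => m _; apply; apply/asboolP.
Qed.

Lemma graph_dist_sym u v : graph_dist u v = graph_dist v u.
Proof.
by apply/eqP; rewrite eqn_leq; apply/andP; split; apply: graph_dist_le;
  exact/walk_sym/graph_dist_walk.
Qed.

Lemma graph_dist_triangle v u w :
  graph_dist u w <= graph_dist u v + graph_dist v w.
Proof. by apply/graph_dist_le/walk_cat; exact: graph_dist_walk. Qed.

Lemma graph_distxx u : graph_dist u u = 0.
Proof. by apply/eqP; rewrite -leqn0; apply/graph_dist_le/walk0. Qed.

Lemma graph_dist_eq0 u v : graph_dist u v = 0 -> u = v.
Proof.
move=> uv0; have := graph_dist_walk u v; rewrite uv0 => w.
by inversion w.
Qed.

End graph_distance.

(* Geometric realization of a connected graph, all edges having length 1: its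
   points are the vertices and the interior points of the edges. *)
Section realization.
Variables (R : realType) (D : connected_graph).
Local Open Scope ring_scope.

Inductive realization : Type :=
  | Vertex of vertex D
  | Inner of edge D & {t : R | 0 < t < 1}.

HB.instance Definition _ := gen_eqMixin realization.
HB.instance Definition _ := gen_choiceMixin realization.

(* The two endpoints of the edge carrying a point p, indexed by a boolean, and
   the distances along this edge from p to them. *)
Definition endpoint (p : realization) (b : bool) : vertex D :=
  match p with
  | Vertex v => v
  | Inner e _ => if b then tgt e else src e
  end.

Definition offset (p : realization) (b : bool) : R :=
  match p with
  | Vertex _ => 0
  | Inner _ t => if b then 1 - val t else val t
  end.

Definition via (p q : realization) (b c : bool) : R :=
  offset p b + (graph_dist (endpoint p b) (endpoint q c))%:R + offset q c.

Definition vertex_route (p q : realization) : R :=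
  Num.min (Num.min (via p q false false) (via p q false true))
          (Num.min (via p q true false) (via p q true true)).

(* Length metric: a shortest path joining p to q either passes through a vertex
   or remains in the interior of an edge. *)
Definition realization_dist (p q : realization) : R :=
  match p, q with
  | Inner e t, Inner e' t' =>
      if `[< e = e' >] then Num.min `|val t - val t'| (vertex_route p q)
      else vertex_route p q
  | _, _ => vertex_route p q
  end.

Lemma offset_ge0 p b : 0 <= offset p b.
Proof. by case: p b => [//|e [t /= /andP[t0 t1]]] [] /=; lra. Qed.

Lemma via_ge0 p q b c : 0 <= via p q b c.
Proof. by rewrite /via !addr_ge0// offset_ge0. Qed.

Lemma vertex_route_le p q b c : vertex_route p q <= via p q b c.
Proof. by rewrite /vertex_route !ge_min; case: b c => [] []; rewrite lexx ?orbT. Qed.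

Lemma vertex_routeP p q : exists b c, vertex_route p q = via p q b c.
Proof.
rewrite /vertex_route.
case: (leP (via p q false false)) => _; case: (leP (via p q true false)) => _;
  case: leP => _; by do 2 eexists.
Qed.

Lemma realization_dist_le p q b c : realization_dist p q <= via p q b c.
Proof.
have := vertex_route_le p q b c; case: p => [v|e t]; case: q => [v'|e' t'] //=.
by case: asboolP => // _ h; rewrite ge_min h orbT.
Qed.

Lemma realization_dist_edge e t t' :
  realization_dist (Inner e t) (Inner e t') <= `|val t - val t'|.
Proof. by rewrite /=; case: asboolP => // _; rewrite ge_min lexx. Qed.

Lemma realization_distP p q :
  (exists b c, realization_dist p q = via p q b c) \/
  (exists e t t', [/\ p = Inner e t, q = Inner e t' &
                      realization_dist p q = `|val t - val t'|]).
Proof.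
have [b [c rE]] := vertex_routeP p q.
case: p q rE => [v|e t] [v'|e' t'] rE; try by left; exists b, c.
rewrite /realization_dist; case: asboolP => [ee'|_]; last by left; exists b, c.
subst e'; case: leP => _; last by left; exists b, c.
by right; exists e, t, t'.
Qed.

Lemma endpoint_dist p b c :
  (graph_dist (endpoint p b) (endpoint p c))%:R <= offset p b + offset p c.
Proof.
have [->|bc] := eqVneq b c.
  by rewrite graph_distxx addr_ge0// offset_ge0.
case: p => [v|e t] /=; first by rewrite graph_distxx addr0.
suff : (graph_dist (src e) (tgt e))%:R <= 1 :> R.
  by case: b c bc => [] [] //= _; rewrite ?[graph_dist (tgt e) _]graph_dist_sym;
    lra.
by rewrite lern1 graph_dist_le//; exact: walk_edge.
Qed.

Lemma viaC p q b c : via p q b c = via q p c b.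
Proof. by rewrite /via graph_dist_sym; lra. Qed.

Lemma realization_dist_sym p q : realization_dist p q = realization_dist q p.
Proof.
suff le p' q' : realization_dist p' q' <= realization_dist q' p'.
  by apply/eqP; rewrite eq_le !le.
case: (realization_distP q' p') => [[b [c ->]]|[e [t [t' [-> -> ->]]]]].
  by rewrite viaC realization_dist_le.
by rewrite distrC realization_dist_edge.
Qed.

Lemma realization_distxx p : realization_dist p p = 0.
Proof.
apply/eqP; rewrite eq_le; apply/andP; split.
  case: p => [v|e t].
    apply: le_trans (realization_dist_le _ _ true true) _.
    by rewrite /via /= graph_distxx !addr0.
  by apply: le_trans (realization_dist_edge _ _ _) _; rewrite subrr normr0.
by case: (realization_distP p p) => [[b [c ->]]|[e [t [t' [_ _ ->]]]]] //;
  exact: via_ge0.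
Qed.

Lemma realization_dist_eq0 p q : realization_dist p q = 0 -> p = q.
Proof.
case: (realization_distP p q) => [[b [c ->]]|[e [t [t' [-> -> ->]]]]].
  have p0 := offset_ge0 p b; have q0 := offset_ge0 q c.
  have d0 := ler0n R (graph_dist (endpoint p b) (endpoint q c)).
  rewrite /via => e.
  have {}p0 : offset p b = 0 by lra.
  have {}q0 : offset q c = 0 by lra.
  have {e d0} : (graph_dist (endpoint p b) (endpoint q c))%:R = 0 :> R by lra.
  case: p p0 => [v _|e t /=]; last by have /andP[] := valP t; case: b => /= ? ? ?; exfalso; lra.
  case: q q0 => [v' _|e t /=]; last by have /andP[] := valP t; case: c => /= ? ? ?; exfalso; lra.
  by move=> /eqP; rewrite pnatr_eq0 => /eqP/graph_dist_eq0 /= ->.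
by move=> /eqP; rewrite normr_eq0 subr_eq0 => /eqP/val_inj ->.
Qed.

Lemma offset_lip e t t' b :
  offset (Inner e t) b <= `|val t - val t'| + offset (Inner e t') b.
Proof.
have := ler_norm (val t - val t'); have := ler_norm (- (val t - val t')).
by rewrite normrN; case: b => /=; lra.
Qed.

Lemma realization_dist_triangle q p r :
  realization_dist p r <= realization_dist p q + realization_dist q r.
Proof.
case: (realization_distP p q) => [[b [c ->]]|[e [t [t' [pE qE ->]]]]];
    case: (realization_distP q r) => [[c' [d ->]]|[f [s [s' [qE' rE ->]]]]].
- apply: le_trans (realization_dist_le _ _ b d) _; rewrite /via.
  have h1 : (graph_dist (endpoint p b) (endpoint r d))%:R <=
    (graph_dist (endpoint p b) (endpoint q c))%:R +
    (graph_dist (endpoint q c) (endpoint q c'))%:R +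
    (graph_dist (endpoint q c') (endpoint r d))%:R :> R.
    rewrite -!natrD ler_nat.
    apply: leq_trans (graph_dist_triangle (endpoint q c') _ _) _.
    by rewrite leq_add2r graph_dist_triangle.
  have := endpoint_dist q c c'; lra.
- apply: le_trans (realization_dist_le _ _ b c) _; rewrite /via qE' rE /=.
  by have := offset_lip f s' s c; rewrite distrC /=; lra.
- apply: le_trans (realization_dist_le _ _ c' d) _; rewrite /via qE pE /=.
  by have := offset_lip e t t' c'; rewrite /=; lra.
- move: qE'; rewrite pE rE qE => -[ef ts]; rewrite -ef -ts.
  apply: le_trans (realization_dist_edge _ _ _) _.
  exact: ler_distD.
Qed.

HB.instance Definition _ := @isMetric.Build R realization realization_dist
  realization_distxx realization_dist_eq0 realization_dist_sym
  realization_dist_triangle.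

End realization.

Section hyperbolic_spaces.
Context {R : realType}.
Local Open Scope ring_scope.

Definition geodesic_segment (M : metricType R) (x y : M) (A : set M) : Prop :=
  exists (ell : R) (c : R -> M),
    [/\ 0 <= ell, c 0 = x, c ell = y,
        {in `[0, ell] &, forall s t, mdist (c s) (c t) = `|s - t|} &
        A = c @` `[0, ell]].

Definition closed_nbhd (M : metricType R) (delta : R) (A : set M) : set M :=
  [set p | exists2 q, A q & mdist p q <= delta].

(* Meant for geodesic spaces, e.g. realizations of connected graphs. *)
Definition hyperbolic_space (M : metricType R) : Prop :=
  exists2 delta : R, 0 <= delta &
  forall (x y z : M) (A B C : set M),
    geodesic_segment x y A -> geodesic_segment y z B ->
    geodesic_segment z x C ->
    [/\ A `<=` closed_nbhd delta B `|` closed_nbhd delta C,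
        B `<=` closed_nbhd delta C `|` closed_nbhd delta A &
        C `<=` closed_nbhd delta A `|` closed_nbhd delta B].

End hyperbolic_spaces.

Section cayley_graph.
Context {G : groupType} {L : Type}.
Variables (X : set G) (H : L -> groupClosed G).
Local Open Scope group_scope.

Definition cayley_label : Type := (set_type X + {l : L & nontrivial H l})%type.

Definition label_eval (a : cayley_label) : G :=
  match a with
  | inl x => val x
  | inr h => val (projT2 h)
  end.

(* The edge (g, a) goes from g to g a. *)
Definition cayley_edge : Type := (G * cayley_label)%type.
Definition cayley_src (e : cayley_edge) : G := e.1.
Definition cayley_tgt (e : cayley_edge) : G := e.1 * label_eval e.2.

Lemma cayley_connected : rel_generating X H ->
  forall u v : G, exists n, walk cayley_src cayley_tgt n u v.
Proof.
move=> gen.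
pose A : set G := [set g | forall u, exists n, walk cayley_src cayley_tgt n u (u * g)].
have A1 : A 1 by move=> u; exists 0%N; rewrite mulg1; exact: walk0.
have AM x y : A x -> A y -> A (x * y).
  move=> Ax Ay u; have [n un] := Ax u; have [m um] := Ay (u * x).
  by exists (n + m)%N; rewrite mulgA; exact: walk_cat um.
have AV x : A x -> A x^-1.
  move=> Ax u; have [n un] := Ax (u * x^-1); exists n; apply: walk_sym.
  by rewrite mulgVK in un.
have Alab a : A (label_eval a).
  by move=> u; exists 1%N; exact: (@walk_edge _ _ cayley_src cayley_tgt (u, a)).
have [K KA] := set_groupClosed A1 AM AV.
move=> u v.
have : generated_subgroup (X `|` \bigcup_(l in setT) [set h | h \in H l])
         (u^-1 * v) by rewrite gen.
move=> /(_ K) uv; have {uv} : u^-1 * v \in K.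
  apply: uv => x; rewrite inE KA => xE; apply/mem_set; case: xE => [xX|[l _ hl]].
    exact: (Alab (inl (SigSub (mem_set xX)))).
  have [->//|x1] := eqVneq x 1.
  have hx : (x \in H l) && (x != 1) by rewrite x1 andbT.
  exact: (Alab (inr (existT _ l (exist _ x hx)))).
by rewrite KA => /set_mem /(_ u); rewrite mulVKg.
Qed.

Definition cayley_graph (gen : rel_generating X H) : connected_graph :=
  ConnectedGraph (cayley_connected gen).

End cayley_graph.

(* Main.v *)
(* From the linear Dehn function to hyperbolicity: for 1-Lipschitz functions u
   and v, the integral of u dv around a loop of length n is at most K n. To see
   it, replace u on each coset g H_l by a constant; the modified form is closed
   on cosets, so that its integral is exactly invariant under the relations of
   the free product F, however long the conjugators and however many relations
   of the H_l are used. Hence it is bounded by the number of relators in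
   a product of conjugates equal to the loop. Conversely, if a geodesic triangle is not
   D-thin at p, the choice u = max(0, D - d(p, .)) gives an integral of order
   D^2 along a loop of length O(D), so that D is bounded.

   From hyperbolicity to the linear Dehn function: looking at the point of
   a loop farthest from its origin shows that a nontrivial loop contains
   a subpath of bounded length which is not geodesic. Shortening it costs
   a bounded loop, hence, the relative Dehn function being finite, a bounded
   number of relators, although there may be infinitely many such loops. *)

Require Import Defs.
From HB Require Import structures.
From mathcomp Require Import all_boot all_order all_algebra.
From mathcomp Require Import all_classical all_reals all_analysis.
From mathcomp Require Import lra zify ring.

Set Implicit Arguments.
Unset Strict Implicit.
Unset Printing Implicit Defensive.

Import Order.TTheory GRing.Theory Num.Theory.

Local Open Scope classical_set_scope.

(** * Geodesic metric spaces *)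

Section thin_triangles.
Context {R : realType} {M : metricType R}.
Local Open Scope ring_scope.
Implicit Types (x y z p q : M) (A B C : set M) (u v : M -> R).

Lemma geodesic_segment_ends x y A : geodesic_segment x y A -> A x /\ A y.
Proof.
case=> ell [c [l0 <- <- _ ->]]; split; [exists 0|exists ell] => //=;
  by rewrite in_itv /= ?lexx ?l0.
Qed.

Lemma geodesic_segment_sym x y A :
  geodesic_segment x y A -> geodesic_segment y x A.
Proof.
case=> ell [c [l0 cx cy cd ->]]; exists ell, (fun r => c (ell - r)); split => //.
- by rewrite subr0.
- by rewrite subrr.
- move=> s t; rewrite !in_itv /= => /andP[s0 s1] /andP[t0 t1].
  rewrite cd ?in_itv /=; try by apply/andP; split; lra.
  by rewrite distrC; congr (`|_|); lra.
- apply/seteqP; split=> _ [r /= ri <-]; exists (ell - r);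
    rewrite ?subKr // in_itv /=; move: ri; rewrite in_itv /=;
    by move=> /andP[r0 r1]; apply/andP; split; lra.
Qed.

Lemma geodesic_segment_dist x y A p : geodesic_segment x y A -> A p ->
  mdist x p + mdist p y = mdist x y.
Proof.
case=> ell [c [l0 <- <- cd ->]] [r /= ri <-].
have i0 : 0 \in `[0, ell] by rewrite in_itv /= lexx l0.
have i1 : ell \in `[0, ell] by rewrite in_itv /= lexx l0.
rewrite !cd //; move: ri; rewrite in_itv /= => /andP[r0 r1].
rewrite !sub0r !normrN (ger0_norm r0) (ger0_norm l0) distrC ger0_norm; lra.
Qed.

Lemma geodesic_segment_point x y A r : geodesic_segment x y A ->
  0 <= r <= mdist x y -> exists2 p, A p & mdist x p = r.
Proof.
case=> ell [c [l0 <- <- cd ->]].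
have i0 : 0 \in `[0, ell] by rewrite in_itv /= lexx l0.
have i1 : ell \in `[0, ell] by rewrite in_itv /= lexx l0.
rewrite cd // sub0r normrN (ger0_norm l0) => ri.
exists (c r); first by exists r => //=; rewrite in_itv.
by rewrite cd ?in_itv //= sub0r normrN ger0_norm //; case/andP: ri.
Qed.

Lemma geodesic_subsegment x y A p q : geodesic_segment x y A -> A p -> A q ->
  exists2 B, geodesic_segment p q B & B `<=` A.
Proof.
have mono (c : R -> M) ell s t : 0 <= s -> s <= t -> t <= ell ->
    {in `[0, ell] &, forall s t, mdist (c s) (c t) = `|s - t|} ->
    exists2 B, geodesic_segment (c s) (c t) B & B `<=` c @` `[0, ell].
  move=> s0 st tl cd; exists ((fun r => c (s + r)) @` `[0, t - s]).
    exists (t - s), (fun r => c (s + r)); split => //; first lra.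
    - by rewrite addr0.
    - by rewrite addrC subrK.
    - move=> a b; rewrite !in_itv /= => /andP[a0 a1] /andP[b0 b1].
      rewrite cd ?in_itv /=; try by apply/andP; split; lra.
      by congr (`|_|); lra.
  move=> _ [r /= ri <-]; exists (s + r) => //=; move: ri.
  by rewrite !in_itv /= => /andP[r0 r1]; apply/andP; split; lra.
case=> ell [c [l0 cx cy cd ->]] [s /= si <-] [t /= ti <-].
move: si ti; rewrite !in_itv /= => /andP[s0 s1] /andP[t0 t1].
have [st|/ltW ts] := leP s t; first exact: mono.
have [B tB BA] := mono c ell t s t0 ts s1 cd.
by exists B => //; exact: geodesic_segment_sym.
Qed.

(** If c shortened some interval [a, b], the triangle inequality through c a and c b would bring the
    two ends closer than [ell]. *)
Lemma geodesic_segment_lipschitz (c : R -> M) (ell : R) : 0 <= ell ->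
  (forall a b, 0 <= a -> a <= b -> b <= ell -> mdist (c a) (c b) <= b - a) ->
  ell <= mdist (c 0) (c ell) ->
  geodesic_segment (c 0) (c ell) (c @` `[0, ell]).
Proof.
move=> l0 cL lc; exists ell, c; split => //.
have cE a b : 0 <= a -> a <= b -> b <= ell -> mdist (c a) (c b) = b - a.
  move=> a0 ab bl; apply/eqP; rewrite eq_le cL //=.
  have := metric_triangle (c 0) (c a) (c ell).
  have := metric_triangle (c a) (c b) (c ell).
  have := cL 0 a (lexx _) a0 (le_trans ab bl).
  by have := cL b ell (le_trans a0 ab) bl (lexx _); lra.
move=> a b; rewrite !in_itv /= => /andP[a0 al] /andP[b0 bl].
have [ab|/ltW ba] := leP a b.
  by rewrite cE // distrC ger0_norm // subr_ge0.
by rewrite metric_sym cE // ger0_norm // subr_ge0.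
Qed.

Lemma geodesic_segment_cat x y z A B : geodesic_segment x y A ->
  geodesic_segment y z B -> mdist x y + mdist y z <= mdist x z ->
  exists2 C, geodesic_segment x z C & C y.
Proof.
case=> l [c [l0 <- cl cd _]] [m [b [m0 b0 <- bd _]]].
have i0 : 0 \in `[0, l] by rewrite in_itv /= lexx l0.
have il : l \in `[0, l] by rewrite in_itv /= lexx l0.
have j0 : 0 \in `[0, m] by rewrite in_itv /= lexx m0.
have jm : m \in `[0, m] by rewrite in_itv /= lexx m0.
have -> : mdist (c 0) y = l by rewrite -cl cd // sub0r normrN ger0_norm.
have -> : mdist y (b m) = m by rewrite -b0 bd // sub0r normrN ger0_norm.
move=> lm; pose e r := if r <= l then c r else b (r - l).
have eb r : l <= r -> e r = b (r - l).
  move=> lr; rewrite /e; case: (leP r l) => // rl.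
  have -> : r = l by apply/eqP; rewrite eq_le rl.
  by rewrite subrr b0.
have e0 : e 0 = c 0 by rewrite /e l0.
have em : e (l + m) = b m by rewrite eb ?lerDl // addrC addKr.
have := @geodesic_segment_lipschitz e (l + m); rewrite e0 em => H.
exists (e @` `[0, l + m]).
  apply: H => //; first by rewrite addr_ge0.
  have el (p q : R) : 0 <= p -> p <= q -> q <= l -> mdist (e p) (e q) <= q - p.
    move=> p0 pq ql; rewrite /e (le_trans pq ql) ql cd; last 2 first.
    - by rewrite in_itv /= p0 (le_trans pq ql).
    - by rewrite in_itv /= ql (le_trans p0 pq).
    by rewrite distrC ger0_norm // subr_ge0.
  have er (p q : R) : l <= p -> p <= q -> q <= l + m -> mdist (e p) (e q) <= q - p.
    move=> p0 pq ql; rewrite !eb //; last lra.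
    rewrite bd ?in_itv /=; try by apply/andP; split; lra.
    by rewrite distrC ger0_norm; lra.
  move=> p q p0 pq qlm; have [ql|/ltW lq] := leP q l; first exact: el.
  have [pl|/ltW lp] := leP p l; last exact: er.
  apply: le_trans (metric_triangle _ (e l) _) _.
  have := el p l p0 pl (lexx _); have := er l q (lexx _) lq qlm; lra.
by exists l; rewrite /= ?in_itv /= ?l0 ?lerDl // /e lexx.
Qed.

Lemma geodesic_segment_refl x : geodesic_segment x x [set x].
Proof.
exists 0, (fun=> x); split => //.
  move=> s t; rewrite !in_itv /= => s0 t0.
  by rewrite mdistxx; apply/esym/eqP; rewrite normr_eq0; apply/eqP; lra.
apply/seteqP; split=> [_ ->|_ [r _ <-]] //.
by exists 0; rewrite //= in_itv /= lexx.
Qed.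

(* The Riemann sum J of u dv along a path from p to r with n jumps of length at
   most 1. *)
Inductive line_sum u v : nat -> M -> M -> R -> Prop :=
  | line_sum0 p : line_sum u v 0 p p 0
  | line_sumS n p q r J : mdist p q <= 1 -> line_sum u v n q r J ->
      line_sum u v n.+1 p r (u p * (v q - v p) + J).

Lemma line_sum_cat u v n m p q r I J : line_sum u v n p q I ->
  line_sum u v m q r J -> line_sum u v (n + m) p r (I + J).
Proof.
elim=> [s|{}n s {}p {}q {}I sp _ IH] qr; first by rewrite add0r.
by rewrite addSn -addrA; apply: line_sumS => //; exact: IH.
Qed.

(** The curve is cut into unit steps and a last step of length at most 1, whence the extra 1 in the
    count; each step contributes at least k times its length. *)
Lemma line_sum_curve u v (c : R -> M) (k s t : R) : s <= t ->
  (forall a b, s <= a -> a <= b -> b <= t -> mdist (c a) (c b) <= b - a) ->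
  (forall a b, s <= a -> a <= b -> b <= t ->
     k * (b - a) <= u (c a) * (v (c b) - v (c a))) ->
  exists n J, [/\ line_sum u v n (c s) (c t) J, n%:R <= t - s + 1 &
                  k * (t - s) <= J].
Proof.
have [N] : exists N : nat, t - s <= N%:R.
  exists (Num.bound `|t - s|); apply: ltW.
  exact: le_lt_trans (ler_norm _) (archi_boundP (normr_ge0 _)).
elim: N s => [|N IH] s tN st cL cI.
  have -> : s = t by apply/eqP; rewrite eq_le st /=; lra.
  by exists 0%N, 0; split; [exact: line_sum0|lra|rewrite subrr mulr0].
have [ts1|ts1] := leP (t - s) 1.
  exists 1%N, (u (c s) * (v (c t) - v (c s)) + 0); split.
  - by apply: line_sumS (line_sum0 _ _ _); apply: le_trans ts1; exact: cL.
  - by lra.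
  - by rewrite addr0; exact: cI.
have [||||n [J [nJ nle Jle]]] := IH (s + 1).
- by move: tN; rewrite -natr1; lra.
- by lra.
- by move=> a b sa; apply: cL; lra.
- by move=> a b sa; apply: cI; lra.
exists n.+1, (u (c s) * (v (c (s + 1)) - v (c s)) + J); split.
- apply: line_sumS nJ; apply: le_trans (cL s (s + 1) _ _ _) _; lra.
- by rewrite -natr1; lra.
- by have := cI s (s + 1) (lexx _); rewrite addrAC subrr; lra.
Qed.

(** Used for the pieces of a loop outside the support of u: they add length but cannot lower the
    integral. *)
Lemma line_sum_vanishing u v x y A : geodesic_segment x y A ->
  (forall p, A p -> u p = 0) ->
  exists n J, [/\ line_sum u v n x y J, n%:R <= mdist x y + 1 & 0 <= J].
Proof.
case=> ell [c [l0 <- <- cd ->]] u0.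
have i0 : 0 \in `[0, ell] by rewrite in_itv /= lexx l0.
have i1 : ell \in `[0, ell] by rewrite in_itv /= lexx l0.
rewrite cd // sub0r normrN (ger0_norm l0).
have [||n [J [nJ nl Jl]]] := @line_sum_curve u v c 0 0 ell l0.
- move=> a b a0 ab bl.
  rewrite cd ?in_itv /= ?a0 ?bl ?(le_trans a0 ab) ?(le_trans ab bl)//.
  by rewrite distrC ger0_norm ?lexx // subr_ge0.
- move=> a b a0 ab bl; rewrite u0 ?mul0r //; exists a => //=.
  by rewrite in_itv /= a0 (le_trans ab bl).
by exists n, J; split=> //; move: nl Jl; rewrite subr0 // mul0r.
Qed.

(** * From linear bounds on line sums to thin triangles *)

Definition lipschitz1 u := forall x y, `|u x - u y| <= mdist x y.

(** An analytic linear isoperimetric inequality. A one-sided bound controls both signs, since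
    replacing v by its opposite negates J. *)
Definition linear_line_sums (K : R) := forall u v, lipschitz1 u ->
  lipschitz1 v -> forall n p J, line_sum u v n p p J -> J <= K * n%:R.

Definition geodesic_space := forall x y, exists A, geodesic_segment x y A.

(** Bounding the perimeter by P makes some D trivially admissible, which gives the halving argument
    a starting point. *)
Definition thin_triangles (P D : R) := forall x y z A B C,
  geodesic_segment x y A -> geodesic_segment y z B -> geodesic_segment z x C ->
  mdist x y + mdist y z + mdist z x <= P ->
  forall p, A p -> exists2 q, B q \/ C q & mdist p q <= D.

(** The path from b to c goes through z if z is near. Otherwise it follows B and C towards z over a
    length 20 E and crosses by a geodesic Q, which thinness keeps away from p. *)
Lemma line_sum_detour (P E : R) u v x y z B C b c p : geodesic_space ->
  thin_triangles P E -> 0 <= E ->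
  geodesic_segment y z B -> geodesic_segment z x C ->
  mdist x y + mdist y z + mdist z x <= P ->
  (forall q, B q \/ C q -> u q = 0) ->
  (forall q, 13 * E <= mdist p q -> u q = 0) ->
  B b -> C c -> mdist p b <= 6 * E -> mdist p c <= 6 * E ->
  exists n J, [/\ line_sum u v n b c J, n%:R <= 92 * E + 3 & 0 <= J].
Proof.
move=> geo thin E0 gB gC per uBC ufar Bb Cc pb pc.
have [_ Bz] := geodesic_segment_ends gB.
have [Cz _] := geodesic_segment_ends gC.
have [B' gB' B'B] := geodesic_subsegment gB Bb Bz.
have [C' gC' C'C] := geodesic_subsegment gC Cc Cz.
have bc : mdist b c <= 12 * E.
  by have := metric_triangle b p c; rewrite (metric_sym b p); lra.
have [close|far] := boolP ((mdist b z <= 20 * E) || (mdist c z <= 20 * E)).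
  have [|n [I [nI nle I0]]] := @line_sum_vanishing u v _ _ _ gB'.
    by move=> q /B'B Bq; apply: uBC; left.
  have [|m [J [mJ mle J0]]] :=
      @line_sum_vanishing u v _ _ _ (geodesic_segment_sym gC').
    by move=> q /C'C Cq; apply: uBC; right.
  exists (n + m)%N, (I + J); split; [exact: line_sum_cat nI mJ| |lra].
  rewrite natrD; move: nle mle; rewrite (metric_sym z c).
  have := metric_triangle b c z; have := metric_triangle c b z.
  by rewrite (metric_sym c b); case/orP: close; lra.
move: far; rewrite negb_or -!ltNge => /andP[bz cz].
have [|b' B'b' bb'] := @geodesic_segment_point _ _ _ (20 * E) gB'.
  by apply/andP; split; lra.
have [|c' C'c' cc'] := @geodesic_segment_point _ _ _ (20 * E) gC'.
  by apply/andP; split; lra.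
have [B'b B'z] := geodesic_segment_ends gB'.
have [C'c C'z] := geodesic_segment_ends gC'.
have [B1 gB1 B1B] := geodesic_subsegment gB' B'b B'b'.
have [B2 gB2 B2B] := geodesic_subsegment gB' B'b' B'z.
have [C1 gC1 C1C] := geodesic_subsegment gC' C'c' C'c.
have [C2 gC2 C2C] := geodesic_subsegment gC' C'z C'c'.
have [Q gQ] := geo c' b'.
have eb' := geodesic_segment_dist gB (B'B _ B'b').
have ec' := geodesic_segment_dist gC (C'C _ C'c').
have fb' := geodesic_segment_dist gB' B'b'.
have fc' := geodesic_segment_dist gC' C'c'.
(* q is within E of a point w of B2 or C2; w is at least 20 E from b or c, hence 14 E from p. *)
have Qfar q : Q q -> 13 * E <= mdist p q.
  move=> Qq; have [|w [B2w|C2w] qw] := thin _ _ _ _ _ _ gQ gB2 gC2 _ q Qq.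
  - have := metric_triangle c' x b'; have := metric_triangle x y b'.
    by rewrite (metric_sym c' x); move: ec'; rewrite (metric_sym c' x); lra.
  - have := geodesic_segment_dist gB2 B2w.
    have := metric_triangle b w z; have := metric_triangle b p w.
    have := metric_triangle p q w; have := mdist_ge0 b' w.
    by rewrite (metric_sym b p); lra.
  - have := geodesic_segment_dist gC2 C2w.
    have := metric_triangle c w z; have := metric_triangle c p w.
    have := metric_triangle p q w; have := mdist_ge0 w c'.
    move: fc'; rewrite (metric_sym z w) (metric_sym c p) (metric_sym z c').
    by rewrite (metric_sym w c'); lra.
have [|n1 [J1 [nJ1 nle1 J10]]] := @line_sum_vanishing u v _ _ _ gB1.
  by move=> q /B1B/B'B Bq; apply: uBC; left.
have [|n2 [J2 [nJ2 nle2 J20]]] :=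
    @line_sum_vanishing u v _ _ _ (geodesic_segment_sym gQ).
  by move=> q /Qfar; exact: ufar.
have [|n3 [J3 [nJ3 nle3 J30]]] := @line_sum_vanishing u v _ _ _ gC1.
  by move=> q /C1C/C'C Cq; apply: uBC; right.
exists (n1 + (n2 + n3))%N, (J1 + (J2 + J3)); split; last lra.
  exact: line_sum_cat nJ1 (line_sum_cat nJ2 nJ3).
(* The three pieces have lengths 20 E, at most 20 E + 12 E + 20 E, and 20 E, each rounded up by one
   jump. *)
rewrite !natrD; have := metric_triangle b' b c'; have := metric_triangle b c c'.
rewrite (metric_sym b' b); move: nle3; rewrite (metric_sym c' c); lra.
Qed.

(** Within D / 2 of t the weight is at least D / 2 and v increases at unit speed over a length D;
    elsewhere the weight is nonnegative. *)
Lemma line_sum_peak (D : R) v (c : R -> M) (s1 t s2 : R) : 0 <= D ->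
  s1 <= t - D / 2 -> t + D / 2 <= s2 ->
  (forall a b, s1 <= a -> a <= b -> b <= s2 -> mdist (c a) (c b) = b - a) ->
  (forall a, s1 <= a -> a <= s2 -> v (c a) = a) ->
  exists n J, [/\ line_sum (fun q => Num.max 0 (D - mdist (c t) q)) v n
    (c s1) (c s2) J, n%:R <= s2 - s1 + 3 & D / 2 * D <= J].
Proof.
move=> D0 s1t ts2 cd vc; set u := fun q => _.
have arc k a b : s1 <= a -> a <= b -> b <= s2 ->
    (forall r, a <= r -> r <= b -> k <= u (c r)) ->
    exists n J, [/\ line_sum u v n (c a) (c b) J, n%:R <= b - a + 1 &
                    k * (b - a) <= J].
  move=> s1a ab bs2 ku; apply: line_sum_curve => // r r' ar rr' rb.
    by rewrite cd //; lra.
  rewrite !vc; try lra.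
  by apply: ler_wpM2r; [lra|apply: ku => //; lra].
have u_ge0 q : 0 <= u q by rewrite /u le_max lexx.
have [||//|//|n1 [J1 [nJ1 nle1 J10]]] := @arc 0 s1 (t - D / 2) => //; first lra.
have [||||n2 [J2 [nJ2 nle2 J20]]] := @arc (D / 2) (t - D / 2) (t + D / 2); try lra.
  move=> r r1 r2; rewrite /u le_max; apply/orP; right.
  have [rt|/ltW tr] := leP r t.
    by rewrite metric_sym cd; lra.
  by rewrite cd; lra.
have [||//|//|n3 [J3 [nJ3 nle3 J30]]] := @arc 0 (t + D / 2) s2 => //; first lra.
exists (n1 + (n2 + n3))%N, (J1 + (J2 + J3)); split.
- exact: line_sum_cat nJ1 (line_sum_cat nJ2 nJ3).
- by rewrite !natrD; lra.
- by lra.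
Qed.

(* A point p of A far from B and C is enclosed in a loop of length O(D) which
   avoids the ball of radius D around p except along A; integrating
   max(0, D - d(p, .)) against d(x, .) along it gives at least D^2 / 2. *)
Lemma thin_triangles_half (K P D : R) : geodesic_space -> linear_line_sums K ->
  0 <= K -> 1 + 432 * K <= D -> thin_triangles P (2 * D) -> thin_triangles P D.
Proof.
move=> geo lin K0 KD thin x y z A B C gA gB gC per p Ap.
apply: contrapT => far.
have {}far q : B q \/ C q -> D < mdist p q.
  by move=> BCq; rewrite ltNge; apply/negP => pq; apply: far; exists q.
pose E := 2 * D; pose u q := Num.max 0 (D - mdist p q).
(* Since A is a geodesic from x, v is its arc length parameter. *)
pose v q := mdist x q.
have D1 : 1 <= D by clear -K0 KD; lra.
have E0 : 0 <= E by rewrite /E; clear -D1; lra.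
have u_lip : lipschitz1 u.
  move=> a b; have := metric_triangle p a b; have := metric_triangle p b a.
  rewrite (metric_sym b a) /u ler_norml.
  move=> ? ?; case: (leP 0 (D - mdist p a)) => ?;
    by case: (leP 0 (D - mdist p b)) => ?; apply/andP; split; have := mdist_ge0 a b; lra.
have v_lip : lipschitz1 v.
  move=> a b; have := metric_triangle x a b; have := metric_triangle x b a.
  by rewrite (metric_sym b a) /v ler_norml => ? ?; apply/andP; split; lra.
have u0 q : D <= mdist p q -> u q = 0.
  by move=> h; rewrite /u; case: (leP 0 (D - mdist p q)) => //; lra.
have uBC q : B q \/ C q -> u q = 0 by move=> /far /ltW; exact: u0.
have u13 q : 13 * E <= mdist p q -> u q = 0.
  by move=> h; apply: u0; move: h E0; rewrite /E; lra.
(* On a single side the subsegment itself avoids the support of u; only a change of side needs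
   [line_sum_detour]. *)
have detour (b c : M) : B b \/ C b -> B c \/ C c -> mdist p b <= 6 * E ->
    mdist p c <= 6 * E ->
    exists n J, [/\ line_sum u v n b c J, n%:R <= 92 * E + 3 & 0 <= J].
  have side S y' z' : geodesic_segment y' z' S -> (forall q, S q -> u q = 0) ->
      S b -> S c -> mdist p b <= 6 * E -> mdist p c <= 6 * E ->
      exists n J, [/\ line_sum u v n b c J, n%:R <= 92 * E + 3 & 0 <= J].
    move=> gS uS Sb Sc pb pc.
    have [S' gS' S'S] := geodesic_subsegment gS Sb Sc.
    have [|n [J [nJ nle J0]]] := @line_sum_vanishing u v _ _ _ gS'.
      by move=> q /S'S; exact: uS.
    exists n, J; split=> //; have := metric_triangle b p c.
    by rewrite (metric_sym b p); lra.
  case=> [Bb|Cb] [Bc|Cc] pb pc.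
  - by apply: (side B y z) => // q Bq; apply: uBC; left.
  - exact: (line_sum_detour v geo thin E0 gB gC per uBC u13).
  - apply: (line_sum_detour v geo thin E0 (geodesic_segment_sym gC)
      (geodesic_segment_sym gB) _ _ u13) => //.
    + by rewrite (metric_sym y x) (metric_sym x z) (metric_sym z y); lra.
    + by move=> q qCB; apply: uBC; case: qCB; [right|left].
  - by apply: (side C z x) => // q Cq; apply: uBC; right.
have [By _] := geodesic_segment_ends gB.
have [_ Cx] := geodesic_segment_ends gC.
have px := far x (or_intror Cx); have py := far y (or_introl By).
have thinA a : A a -> exists2 q, B q \/ C q & mdist a q <= E
  := thin _ _ _ _ _ _ gA gB gC per a.
case: gA => ell [c [l0 cx cy cd AE]].
have [t /= ti ct] : (c @` `[0, ell]) p by rewrite -AE.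
move: ti; rewrite in_itv /= => /andP[t0 tl].
have {}cd a b : 0 <= a -> a <= b -> b <= ell -> mdist (c a) (c b) = b - a.
  move=> a0 ab bl; rewrite cd ?in_itv /= ?a0 ?bl ?(le_trans a0 ab) ?(le_trans ab bl)//.
  by rewrite distrC ger0_norm // subr_ge0.
have Ac a : 0 <= a -> a <= ell -> A (c a).
  by move=> a0 al; rewrite AE; exists a => //=; rewrite in_itv /= a0 al.
have vc a : 0 <= a -> a <= ell -> v (c a) = a.
  by move=> a0 al; rewrite /v -cx cd // subr0.
have Dt : D < t by move: px; rewrite -ct -cx metric_sym cd // subr0.
have Dlt : D < ell - t by move: py; rewrite -ct -cy cd.
(* Cutting A at distance 5 E from p keeps the loop of length O(D), however large the triangle is. *)
pose s1 := Num.max 0 (t - 5 * E); pose s2 := Num.min ell (t + 5 * E).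
have [s10 s1D s1E] : [/\ 0 <= s1, s1 <= t - D / 2 & t - 5 * E <= s1].
  by clear -D1 Dt; rewrite /s1; case: (leP 0 (t - 5 * E)); rewrite /E => ?; split; lra.
have [s2l s2D s2E] : [/\ s2 <= ell, t + D / 2 <= s2 & s2 <= t + 5 * E].
  by clear -D1 Dlt tl; rewrite /s2; case: (leP ell (t + 5 * E)); rewrite /E => ?; split; lra.
(* The known E-thinness gives a spoke of length at most E to B or C, which stays at least 4 E = 8 D
   from p, where u vanishes. Line sums being oriented, both directions are recorded. *)
have spoke s : 0 <= s -> s <= ell -> mdist p (c s) = 5 * E ->
    exists b n J, [/\ B b \/ C b, mdist p b <= 6 * E,
      line_sum u v n b (c s) J, n%:R <= E + 1 & 0 <= J] /\
    exists m I, [/\ line_sum u v m (c s) b I, m%:R <= E + 1 & 0 <= I].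
  move=> s0 sl ps; have [b BCb sb] := thinA _ (Ac _ s0 sl).
  have [S gS] := geo b (c s).
  have uS q : S q -> u q = 0.
    move=> Sq; apply: u0; have := geodesic_segment_dist gS Sq.
    have := metric_triangle p q (c s); have := mdist_ge0 b q.
    by move: E0 sb; rewrite (metric_sym b (c s)) ps /E; lra.
  have [n [J [nJ nle J0]]] := line_sum_vanishing v gS uS.
  have [m [I [mI mle I0]]] := line_sum_vanishing v (geodesic_segment_sym gS) uS.
  exists b, n, J; split; last by exists m, I; split=> //; lra.
  split=> //; last by move: nle; rewrite (metric_sym b); lra.
  by have := metric_triangle p (c s) b; lra.
have [b1 [n1 [J1 [BCb1 pb1 nJ1 nle1 J10]]]] : exists b n J,
    [/\ B b \/ C b, mdist p b <= 6 * E, line_sum u v n b (c s1) J,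
        n%:R <= E + 1 & 0 <= J].
  have [t5|t5] := leP t (5 * E).
    (* Here the cut point is x, which already lies on C: the spoke is empty. *)
    have -> : s1 = 0 by rewrite /s1 max_l //; lra.
    rewrite cx; exists x, 0%N, 0; split; rewrite ?lexx //;
      [by right| |exact: line_sum0|lra].
    by rewrite -ct -cx metric_sym cd // subr0; lra.
  have s1E' : s1 = t - 5 * E by rewrite /s1 max_r //; lra.
  have [||b [n [J [h _]]]] := spoke s1 s10; first lra.
    by rewrite -ct metric_sym cd //; lra.
  by exists b, n, J.
have [b2 [n2 [J2 [BCb2 pb2 nJ2 nle2 J20]]]] : exists b n J,
    [/\ B b \/ C b, mdist p b <= 6 * E, line_sum u v n (c s2) b J,
        n%:R <= E + 1 & 0 <= J].
  have [t5|t5] := leP (ell - t) (5 * E).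
    have -> : s2 = ell by rewrite /s2 min_l //; lra.
    rewrite cy; exists y, 0%N, 0; split; rewrite ?lexx //;
      [by left| |exact: line_sum0|lra].
    by rewrite -ct -cy cd //; lra.
  have s2E' : s2 = t + 5 * E by rewrite /s2 min_r //; lra.
  have [|||b [n [J [[BCb pb _ _ _] [m [I [mI mle I0]]]]]]] := spoke s2 => //; first lra.
    by rewrite -ct cd //; lra.
  by exists b, m, I.
have [n3 [J3 [nJ3 nle3 J30]]] := detour b2 b1 BCb2 BCb1 pb2 pb1.
have [|||||n4 [J4 [nJ4 nle4 J40]]] := @line_sum_peak D v c s1 t s2 => //.
- by clear -D1; lra.
- by move=> a b s1a ab bs2; rewrite cd // ?(le_trans bs2) ?(le_trans s10).
- by move=> a s1a as2; rewrite vc ?(le_trans as2) ?(le_trans s10).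
rewrite ct in nJ4.
have loop := line_sum_cat nJ1 (line_sum_cat nJ4 (line_sum_cat nJ2 nJ3)).
have := lin _ _ u_lip v_lip _ _ _ loop; rewrite !natrD.
set N := (X in K * X) => KN.
(* Two spokes of E + 1 jumps, 10 E + 3 along A and 92 E + 3 for the detour. *)
have /(ler_wpM2l K0) : N <= 104 * E + 8.
  by rewrite /N; clear -nle1 nle2 nle3 nle4 s1E s2E; lra.
have KDK : K * 1 <= K * D by rewrite ler_wpM2l.
have DD : D * (1 + 432 * K) <= D * D.
  by rewrite ler_wpM2l // (le_trans ler01).
(* Since D is at least 1, D^2 / 2 is at most K (208 D + 8), hence at most 216 K D; this contradicts
   1 + 432 K <= D. *)
move: KN; rewrite /E; clear -J10 J20 J30 J40 KDK DD D1; lra.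
Qed.

Theorem linear_line_sums_hyperbolic K : geodesic_space ->
  linear_line_sums K -> hyperbolic_space M.
Proof.
move=> geo lin0; pose K' := Num.max 0 K.
have K0 : 0 <= K' by rewrite /K' le_max lexx.
have lin : linear_line_sums K'.
  move=> u v ul vl n p J /(lin0 u v ul vl) h; apply: le_trans h _.
  by rewrite ler_wpM2r // /K' le_max lexx orbT.
pose D := 1 + 432 * K'; have D1 : 1 <= D by rewrite /D; lra.
have thin P : thin_triangles P D.
  have iter k : thin_triangles P (2 ^+ k * D) -> thin_triangles P D.
    elim: k => [|k IH]; first by rewrite mul1r.
    rewrite exprS -mulrA => /thin_triangles_half h; apply/IH/(h K') => //.
    rewrite -/D ler_peMl //; [lra|exact: exprn_ege1 (ler1n _ 2)].
  have [k Pk] : exists k : nat, P <= k%:R.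
    exists (Num.bound `|P|); apply: ltW.
    exact: le_lt_trans (ler_norm _) (archi_boundP (normr_ge0 _)).
  (* The vertex x lies on C and is within P <= k <= 2^k D of p, so thinness at scale 2^k D is free;
     k halvings bring it down to D. *)
  apply: (iter k) => x y z A B C gA gB gC per p Ap.
  have [_ Cx] := geodesic_segment_ends gC.
  exists x; first by right.
  have := geodesic_segment_dist gA Ap; rewrite metric_sym.
  have := mdist_ge0 p y; have := mdist_ge0 y z; have := mdist_ge0 z x.
  have : k%:R <= 2 ^+ k :> R by rewrite -natrX ler_nat ltnW // ltn_expl.
  have : 2 ^+ k * 1 <= 2 ^+ k * D :> R by rewrite ler_wpM2l // exprn_ge0.
  by lra.
exists D; first lra.
have nbhd x y z A B C : geodesic_segment x y A -> geodesic_segment y z B ->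
    geodesic_segment z x C -> A `<=` closed_nbhd D B `|` closed_nbhd D C.
  move=> gA gB gC p Ap.
  have [q [Bq|Cq] pq] := thin _ _ _ _ _ _ _ gA gB gC (lexx _) p Ap.
    by left; exists q.
  by right; exists q.
move=> x y z A B C gA gB gC; split.
- exact: nbhd gA gB gC.
- exact: nbhd gB gC gA.
- exact: nbhd gC gA gB.
Qed.

(** The hypothesis puts w on a geodesic from x to y; the point q near w on a side ending at z splits
    that side additively, and passing from q to w costs [delta] twice. *)
Lemma hyperbolic_distance_bound : geodesic_space -> hyperbolic_space M ->
  exists2 delta : R, 0 <= delta & forall x y z w,
    mdist x w + mdist w y <= mdist x y ->
    mdist w z <= mdist x z + 2 * delta - mdist x w \/
    mdist w z <= mdist y z + 2 * delta - mdist w y.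
Proof.
move=> geo [delta d0 hyp]; exists delta => // x y z w xwy.
have [A1 gA1] := geo x w; have [A2 gA2] := geo w y.
have [A gA Aw] := geodesic_segment_cat gA1 gA2 xwy.
have [B gB] := geo y z; have [C gC] := geo z x.
have [AH _ _] := hyp _ _ _ _ _ _ gA gB gC.
case: (AH w Aw) => -[q Sq wq].
  right; have := geodesic_segment_dist gB Sq.
  have := metric_triangle w q z; have := metric_triangle w q y.
  by rewrite (metric_sym y q); lra.
left; have := geodesic_segment_dist gC Sq.
have := metric_triangle w q z; have := metric_triangle x q w.
by rewrite (metric_sym z q) (metric_sym q x) (metric_sym q w) (metric_sym z x); lra.
Qed.

End thin_triangles.

(** * Geodesics in the realization of a graph *)

Section realization_geodesics.
Context {R : realType} {D : connected_graph}.
Local Open Scope ring_scope.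
Local Notation M := (realization R D).
Implicit Types (e : edge D) (a b : R) (u v w : vertex D).

Lemma mdist_vertex u v :
  mdist (Vertex R u) (Vertex R v) = (graph_dist u v)%:R.
Proof.
rewrite /mdist /= /vertex_route /via /= !minxx add0r addr0 //.
Qed.

(** Interior points and end vertices come from different constructors; this joins them in one
    parametrization by [0, 1]. *)
Definition edge_point e a : M :=
  if insub a is Some t then Inner e t
  else Vertex R (if a <= 0 then src e else tgt e).

Lemma edge_point0 e : edge_point e 0 = Vertex R (src e).
Proof. by rewrite /edge_point insubF ?lexx // ltxx. Qed.

Lemma edge_point1 e : edge_point e 1 = Vertex R (tgt e).
Proof. by rewrite /edge_point insubF ?ltxx ?andbF // ler10. Qed.

Lemma edge_point_inner e (t : {t : R | 0 < t < 1}) :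
  edge_point e (val t) = Inner e t.
Proof. by rewrite /edge_point valK. Qed.

Lemma edge_pointP e a : 0 <= a -> a <= 1 ->
  [\/ a = 0 /\ edge_point e a = Vertex R (src e),
      a = 1 /\ edge_point e a = Vertex R (tgt e) |
      exists2 t, edge_point e a = Inner e t & val t = a].
Proof.
rewrite le_eqVlt => /predU1P[<-|a0]; first by rewrite edge_point0; constructor 1.
rewrite le_eqVlt => /predU1P[->|a1]; first by rewrite edge_point1; constructor 2.
have ai : 0 < a < 1 by rewrite a0.
constructor 3; exists (exist _ a ai) => //.
exact: (edge_point_inner e (exist _ a ai)).
Qed.

(** Equality may fail, for instance when the edge is a loop. *)
Lemma edge_point_dist_le e a b : 0 <= a -> a <= b -> b <= 1 ->
  mdist (edge_point e a) (edge_point e b) <= b - a.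
Proof.
move=> a0 ab b1.
have [[aE ->]|[aE ->]|[t -> tE]] := edge_pointP e a0 (le_trans ab b1);
  have [[bE ->]|[bE ->]|[s -> sE]] := edge_pointP e (le_trans a0 ab) b1.
- by rewrite mdistxx; lra.
- rewrite mdist_vertex aE bE subr0 lern1 graph_dist_le //; exact: walk_edge.
- apply: le_trans (realization_dist_le _ _ false false) _.
  by rewrite /via /= graph_distxx sE aE; lra.
- by rewrite mdist_vertex; exfalso; lra.
- by rewrite mdistxx; lra.
- by move: (valP s); rewrite /= => /andP[_]; rewrite -[sval s]/(val s) sE; lra.
- by move: (valP t); rewrite /= => /andP[+ _]; rewrite -[sval t]/(val t) tE; lra.
- apply: le_trans (realization_dist_le _ _ true false) _.
  by rewrite /via /= graph_distxx tE bE; lra.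
- apply: le_trans (realization_dist_edge _ _ _) _.
  by rewrite tE sE distrC ger0_norm // subr_ge0.
Qed.

Lemma edge_point_geodesic e a b : 0 <= a -> a <= b -> b <= 1 ->
  b - a <= mdist (edge_point e a) (edge_point e b) ->
  exists A, geodesic_segment (edge_point e a) (edge_point e b) A.
Proof.
move=> a0 ab b1 abd.
have := @geodesic_segment_lipschitz _ _ (fun r => edge_point e (a + r)) (b - a).
rewrite addr0 (addrC a (b - a)) subrK => H; eexists; apply: H => //; first lra.
move=> r s r0 rs sb; apply: le_trans (edge_point_dist_le _ _ _ _) _; lra.
Qed.

(** On a shortest walk the ends of the first edge are at distance 1 and the rest is again shortest,
    so edges can be glued inductively. *)
Lemma vertex_geodesic u v : exists A, geodesic_segment (Vertex R u) (Vertex R v) A.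
Proof.
have edge_geo e : (1 <= graph_dist (src e) (tgt e))%N ->
    exists A, geodesic_segment (Vertex R (src e)) (Vertex R (tgt e)) A.
  move=> e1; rewrite -edge_point0 -edge_point1; apply: edge_point_geodesic => //.
  by rewrite edge_point0 edge_point1 mdist_vertex subr0 ler1n.
suff walk_geo n : walk (@src D) (@tgt D) n u v -> graph_dist u v = n ->
    exists A, geodesic_segment (Vertex R u) (Vertex R v) A.
  exact: walk_geo (graph_dist_walk u v) erefl.
elim=> {n u v} [u _|n e v ev IH uvn|n e v ev IH uvn].
- by exists [set Vertex R u]; exact: geodesic_segment_refl.
- have evn := graph_dist_le ev.
  have := graph_dist_triangle (tgt e) (src e) v; rewrite uvn => tri.
  have e1 : (graph_dist (src e) (tgt e) <= 1)%N by exact/graph_dist_le/walk_edge.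
  have [|A gA] := edge_geo e; first by lia.
  have [|B gB] := IH; first by lia.
  have [|C gC _] := geodesic_segment_cat gA gB; last by exists C.
  by rewrite !mdist_vertex -natrD ler_nat uvn; lia.
- have evn := graph_dist_le ev.
  have := graph_dist_triangle (src e) (tgt e) v; rewrite uvn => tri.
  have e1 : (graph_dist (src e) (tgt e) <= 1)%N by exact/graph_dist_le/walk_edge.
  rewrite (graph_dist_sym (tgt e)) in tri.
  have [|A /geodesic_segment_sym gA] := edge_geo e; first by lia.
  have [|B gB] := IH; first by lia.
  have [|C gC _] := geodesic_segment_cat gA gB; last by exists C.
  by rewrite !mdist_vertex -natrD ler_nat uvn graph_dist_sym; lia.
Qed.

Lemma endpoint_mdist_le (p : M) i : mdist p (Vertex R (endpoint p i)) <= offset p i.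
Proof.
apply: le_trans (realization_dist_le _ _ i i) _.
by rewrite /via /= graph_distxx !addr0.
Qed.

Lemma endpoint_geodesic (p : M) i :
  offset p i <= mdist p (Vertex R (endpoint p i)) ->
  exists A, geodesic_segment p (Vertex R (endpoint p i)) A.
Proof.
case: p => [v _|e t]; first by exists [set Vertex R v]; exact: geodesic_segment_refl.
have /= /andP[/ltW t0 /ltW t1] := valP t.
rewrite -edge_point_inner; case: i => /=.
  by rewrite -edge_point1; exact: edge_point_geodesic.
rewrite -edge_point0 => h.
have [|A /geodesic_segment_sym gA] := @edge_point_geodesic e 0 (val t) (lexx _) t0 t1.
  by rewrite subr0 metric_sym.
by exists A.
Qed.

(** If the distance is attained through end vertices, the triangle inequalities along that route are
    equalities, so its three pieces are geodesic and glue. Otherwise an arc of one edge realizes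
    it. *)
Lemma realization_geodesic_space : @geodesic_space R M.
Proof.
move=> p q; case: (realization_distP p q) => [[i [j pq]]|[e [s [t [-> -> st]]]]].
  have pqE : mdist p q = offset p i +
    mdist (Vertex R (endpoint p i)) (Vertex R (endpoint q j)) + offset q j.
    by rewrite mdist_vertex; exact: pq.
  have pi := endpoint_mdist_le p i; have qj := endpoint_mdist_le q j.
  have t1 := metric_triangle p (Vertex R (endpoint p i)) q.
  have t2 := metric_triangle (Vertex R (endpoint p i)) (Vertex R (endpoint q j)) q.
  rewrite (metric_sym (Vertex R (endpoint q j)) q) in t2.
  have [|A gA] := @endpoint_geodesic p i; first lra.
  have [|C /geodesic_segment_sym gC] := @endpoint_geodesic q j; first lra.
  have [B gB] := vertex_geodesic (endpoint p i) (endpoint q j).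
  have t3 := metric_triangle p (Vertex R (endpoint p i)) (Vertex R (endpoint q j)).
  have t4 := metric_triangle p (Vertex R (endpoint q j)) q.
  rewrite (metric_sym (Vertex R (endpoint q j)) q) in t4.
  have [|E gE _] := geodesic_segment_cat gA gB; first lra.
  have [|F gF _] := geodesic_segment_cat gE gC; last by exists F.
  by rewrite (metric_sym (Vertex R (endpoint q j)) q); lra.
have stE : mdist (Inner e s) (Inner e t) = `|val s - val t| by exact: st.
have /= /andP[/ltW s0 /ltW s1] := valP s; have /= /andP[/ltW t0 /ltW t1] := valP t.
rewrite -!edge_point_inner in stE *.
have [lst|/ltW lts] := leP (val s) (val t).
  by apply: edge_point_geodesic => //; rewrite stE distrC ger0_norm ?subr_ge0.
have [|A /geodesic_segment_sym gA] := @edge_point_geodesic e _ _ t0 lts s1.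
  by rewrite metric_sym stE ger0_norm ?subr_ge0.
by exists A.
Qed.

End realization_geodesics.

(** * Words and areas *)

Section words.
Context {G : groupType} {L : Type} {H : L -> groupClosed G}.
Local Open Scope group_scope.
Implicit Types X Y : set G.

Lemma word_eval_nil X : word_eval ([::] : word X H) = 1.
Proof. by rewrite /word_eval big_nil. Qed.

Lemma word_eval_cons X a (w : word X H) :
  word_eval (a :: w) = letter_eval a * word_eval w.
Proof. by rewrite /word_eval big_cons. Qed.

Lemma word_eval_cat X (u v : word X H) :
  word_eval (u ++ v) = word_eval u * word_eval v.
Proof. by rewrite /word_eval big_cat. Qed.

Lemma letter_eval_inv X (a : letter X H) :
  letter_eval (letter_inv a) = (letter_eval a)^-1.
Proof. by case: a => [x []|l h] //=; rewrite invgK. Qed.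

Lemma word_eval_inv X (w : word X H) :
  word_eval (word_inv w) = (word_eval w)^-1.
Proof.
apply: (@mulgI _ (word_eval w)); rewrite -word_eval_cat mulgV.
rewrite -(word_eval_nil X); exact/word_eval_equiv/word_equiv_mulV.
Qed.

Lemma size_word_inv X (w : word X H) : size (word_inv w) = size w.
Proof. by rewrite /word_inv size_rev size_map. Qed.

Lemma letter_walk X (g : G) (a : letter X H) :
  walk (@cayley_src _ _ X H) (@cayley_tgt _ _ X H) 1 g (g * letter_eval a).
Proof.
case: a => [x []|l h] /=.
- exact: (@walk_edge _ _ (@cayley_src _ _ X H) (@cayley_tgt _ _ X H) (g, inl x)).
- apply: walk_sym.
  have := @walk_edge _ _ (@cayley_src _ _ X H) (@cayley_tgt _ _ X H)
    (g * (val x)^-1, inl x).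
  by rewrite /cayley_tgt /= mulgVK.
- exact: (@walk_edge _ _ (@cayley_src _ _ X H) (@cayley_tgt _ _ X H)
    (g, inr (existT _ l h))).
Qed.

Lemma word_walk X (g : G) (w : word X H) :
  walk (@cayley_src _ _ X H) (@cayley_tgt _ _ X H) (size w) g (g * word_eval w).
Proof.
elim: w g => [|a w IH] g; first by rewrite word_eval_nil mulg1; exact: walk0.
rewrite word_eval_cons mulgA /= -(add1n (size w)).
exact: walk_cat (letter_walk g a) (IH _).
Qed.

Definition label_letter X (a : cayley_label X H) : letter X H :=
  match a with
  | inl x => Gen H x true
  | inr h => Par X (projT2 h)
  end.

Lemma label_letter_eval X (a : cayley_label X H) :
  letter_eval (label_letter a) = label_eval a.
Proof. by case: a. Qed.

Lemma walk_word X n (g h : G) :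
  walk (@cayley_src _ _ X H) (@cayley_tgt _ _ X H) n g h ->
  exists2 w : word X H, size w = n & g * word_eval w = h.
Proof.
elim=> {n g h} [g|n [g a] h _ [w <- <-]|n [g a] h _ [w <- <-]].
- by exists [::]; rewrite // word_eval_nil mulg1.
- exists (label_letter a :: w) => //.
  by rewrite word_eval_cons label_letter_eval mulgA.
- exists (letter_inv (label_letter a) :: w) => //.
  rewrite word_eval_cons letter_eval_inv label_letter_eval mulgA.
  by rewrite /cayley_tgt /= mulgK.
Qed.

Lemma rel_generating_word X (g : G) : rel_generating X H ->
  exists w : word X H, word_eval w = g.
Proof.
move=> genX; have [n /walk_word[w _ <-]] := cayley_connected genX 1 g.
by exists w; rewrite mul1g.
Qed.

(** Passes between the given X and the generating set of a presentation with bounded stretching: X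
    is finite, and letters of the H_l are kept. *)
Lemma letter_translation X Y : finite_set X -> rel_generating Y H ->
  exists (m : nat) (tau : letter X H -> word Y H), forall a,
    (size (tau a) <= m)%N /\ word_eval (tau a) = letter_eval a.
Proof.
move=> finX genY.
have /finite_seqP[s Xs] := finX.
have [F FE] := choice (fun g : G => rel_generating_word g genY).
pose m := (\max_(x <- s) (size (F x) + size (F x^-1)%g))%N.
have Fm x : X x -> (size (F x) + size (F x^-1) <= m)%N.
  move=> Xx; apply: (@leq_bigmax_seq _ _ xpredT
    (fun x => size (F x) + size (F x^-1))%N) => //.
  by move: Xx; rewrite Xs.
(* The successor leaves room for a letter of some H_l when m is 0. *)
exists m.+1, (fun a => match a with
  | Gen x b => F (if b then val x else (val x)^-1)
  | Par l h => [:: Par Y h] end).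
case=> [x b|l h]; last by split=> //; rewrite /word_eval big_seq1.
have /Fm xm : X (val x) := set_mem (valP x).
by rewrite FE; split=> //; case: b; lia.
Qed.

Definition flatmap X Y (tau : letter X H -> word Y H) (w : word X H) : word Y H :=
  flatten (map tau w).

(** * Areas of elements of the free product *)

Section area.
Context {X : set G} (Rel : set (word X H)).

(** Lists replace families indexed by ['I_k], so that products of relator expressions are
    concatenations. *)
Definition rel_area (k : nat) (f : free_prod X H) : Prop :=
  exists s : seq (free_prod X H * word X H),
    [/\ (size s <= k)%N, {in s, forall x, Rel x.2} &
        f = \prod_(x <- s) (x.1^-1 * of_word x.2 * x.1)].

Lemma rel_area1 k : rel_area k 1.
Proof. by exists [::]; split => //; rewrite big_nil. Qed.

Lemma rel_areaW k l f : (k <= l)%N -> rel_area k f -> rel_area l f.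
Proof. by move=> kl [s [sk sR fE]]; exists s; split=> //; exact: leq_trans kl. Qed.

Lemma rel_areaM k l f g :
  rel_area k f -> rel_area l g -> rel_area (k + l) (f * g).
Proof.
move=> [s [sk sR ->]] [t [tl tR ->]]; exists (s ++ t); split.
- by rewrite size_cat leq_add.
- by move=> x; rewrite mem_cat => /orP[/sR|/tR].
- by rewrite big_cat.
Qed.

Lemma rel_areaJ k f g : rel_area k f -> rel_area k (g * f * g^-1).
Proof.
move=> [s [sk sR ->]]; exists [seq (x.1 * g^-1, x.2) | x <- s]; split.
- by rewrite size_map.
- by move=> _ /mapP[x /sR Rx ->].
rewrite big_map /=; elim: s {sk sR} => [|x s IH].
  by rewrite !big_nil mulg1 mulgV.
by rewrite !big_cons -IH invgM invgK !mulgA mulgVK.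
Qed.

Lemma rel_isoperimetricP (f : nat -> nat) : rel_isoperimetric Rel f <->
  forall n w, (size w <= n)%N -> word_eval w = 1 -> rel_area (f n) (of_word w).
Proof.
split=> h n w wn w1.
  have [k [c [r [kn Rr wE]]]] := h n w wn w1.
  exists [seq (c i, r i) | i <- index_enum 'I_k]; split.
  - by rewrite size_map /index_enum -enumT size_enum_ord.
  - by move=> _ /mapP[i _ ->]; exact: Rr.
  - by rewrite big_map.
have [s [sk sR wE]] := h n w wn w1.
exists (size s), (fun i => (tnth (in_tuple s) i).1), (fun i => (tnth (in_tuple s) i).2).
split=> //; first by move=> i; apply/sR/mem_tnth.
by rewrite wE big_tnth.
Qed.

End area.

Lemma flatmap_eval X Y (tau : letter X H -> word Y H) w :
  (forall a, word_eval (tau a) = letter_eval a) ->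
  word_eval (flatmap tau w) = word_eval w.
Proof.
move=> tauE; elim: w => [|a w IH]; first by rewrite !word_eval_nil.
by rewrite /flatmap /= word_eval_cat tauE word_eval_cons -IH.
Qed.

Lemma flatmap_size X Y (tau : letter X H -> word Y H) w m :
  (forall a, size (tau a) <= m)%N -> (size (flatmap tau w) <= m * size w)%N.
Proof.
move=> taum; elim: w => [|a w IH]; first by rewrite muln0.
by rewrite /flatmap /= size_cat mulnS leq_add.
Qed.

Lemma flatmap_cat X Y (tau : letter X H -> word Y H) u v :
  flatmap tau (u ++ v) = flatmap tau u ++ flatmap tau v.
Proof. by rewrite /flatmap map_cat flatten_cat. Qed.

End words.

(** * Hyperbolicity implies a linear Dehn function *)

Section hyperbolic_to_dehn.
Context {R : realType} {G : groupType} {L : Type} {H : L -> groupClosed G}.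
Context {X : set G} (genX : rel_generating X H).
Local Open Scope group_scope.
Local Notation d := (@graph_dist (cayley_graph genX)).

Lemma hyperbolic_graph_dist :
  hyperbolic_space (realization R (cayley_graph genX)) ->
  exists K : nat, forall x y z w : G, (d x w + d w y <= d x y)%N ->
    (d w z + d x w < d x z + K)%N \/ (d w z + d w y < d y z + K)%N.
Proof.
move=> /(hyperbolic_distance_bound realization_geodesic_space)[delta d0 hyp].
exists (Num.bound (2 * delta)%R) => x y z w xwy.
have dK : (2 * delta < (Num.bound (2 * delta))%:R)%R.
  by apply: archi_boundP; lra.
pose V (g : G) := Vertex R (g : vertex (cayley_graph genX)).
have := hyp (V x) (V y) (V z) (V w).
rewrite !mdist_vertex -natrD ler_nat => /(_ xwy)[] h; [left|right];
  by rewrite -(ltr_nat R) !natrD; lra.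
Qed.

(** Take a point of the loop farthest from 1, the middle of a window of 2K letters. If the window is
    geodesic, thinness forces one of its ends to be farther still. *)
Lemma shortcut (K : nat) (w : word X H) :
  (forall x y z w : G, (d x w + d w y <= d x y)%N ->
    (d w z + d x w < d x z + K)%N \/ (d w z + d w y < d y z + K)%N) ->
  w <> [::] -> word_eval w = 1 ->
  exists a s b s' : word X H, [/\ w = a ++ s ++ b, (size s <= 2 * K)%N,
    (size s' < size s)%N & word_eval s' = word_eval s].
Proof.
move=> hyp w0 w1; apply: contrapT => noshort.
pose n := size w; have n0 : (0 < n)%N by rewrite /n lt0n size_eq0; apply/eqP.
pose g i := word_eval (take i w).
have g0 : g 0%N = 1 by rewrite /g take0 word_eval_nil.
have gn : g n = 1 by rewrite /g take_size.
(* A shorter walk between the ends of such a window would provide the missing s'. *)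
have geo i j : (i <= j)%N -> (j <= n)%N -> (j <= i + 2 * K)%N ->
    d (g i) (g j) = (j - i)%N.
  move=> ij jn jiK; pose s := take (j - i) (drop i w).
  have sj : size s = (j - i)%N by rewrite size_takel // size_drop -/n; lia.
  have gj : g j = g i * word_eval s.
    rewrite -word_eval_cat; congr word_eval.
    by rewrite -{1}(subnKC ij) takeD.
  have le : (d (g i) (g j) <= j - i)%N.
    by apply: graph_dist_le; rewrite gj -sj; exact: word_walk.
  apply/eqP; rewrite eqn_leq le leqNgt; apply/negP => lt.
  have [s' s'E s'j] := walk_word
    (graph_dist_walk (g i : vertex (cayley_graph genX)) (g j)).
  apply: noshort; exists (take i w), s, (drop j w), s'; split.
  - rewrite /s -[LHS](cat_take_drop i); congr (_ ++ _).
    by rewrite -{1}[drop i w](cat_take_drop (j - i)) drop_drop subnK.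
  - by rewrite sj; lia.
  - by rewrite s'E sj.
  - by apply: (@mulgI _ (g i)); rewrite s'j gj.
have [t tn tmax] : exists2 t, (t <= n)%N &
    forall i, (i <= n)%N -> (d (g i) 1%g <= d (g t) 1%g)%N.
  have [t _ tmax] := @arg_maxnP _ (@ord0 n) xpredT (fun i => d (g i) 1%g) isT.
  exists (t : nat); first by have := ltn_ord t; lia.
  by move=> i; rewrite -ltnS => ilt; exact: (tmax (Ordinal ilt)).
have d00 : d 1 1 = 0%N by exact: graph_distxx.
have [nK|Kn] := leqP n (2 * K).
  have := geo 0%N n; rewrite g0 gn d00; lia.
have tK : (K <= d (g t) 1%g)%N.
  have := tmax K; have := geo 0%N K.
  by rewrite g0 graph_dist_sym; lia.
pose i := (t - K)%N; pose j := minn n (t + K).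
have := hyp (g i) (g j) 1%g (g t); rewrite !geo; try lia.
have := tmax i; have := tmax j.
(* A window cut off at an end of w ends at 1, and the alternative on that side gives d (g t) 1 < K,
   against [tK]; on a full side it contradicts [tmax]. *)
have [ti|ti] : i = 0%N \/ (t - i = K)%N by lia.
  have [tj|tj] : j = n \/ (j - t = K)%N by lia.
    by rewrite ti tj g0 gn d00; lia.
  by rewrite ti g0 d00; lia.
have [tj|tj] : j = n \/ (j - t = K)%N by lia.
  by rewrite tj gn d00; lia.
lia.
Qed.

(** Induction on the length of w: each shortcut removes at least one letter and costs at most C
    relators. *)
Lemma flatmap_area (Y : set G) (Rel : set (word Y H)) (f : nat -> nat)
    (m : nat) (tau : letter X H -> word Y H) :
  rel_isoperimetric Rel f ->
  (forall a, (size (tau a) <= m)%N /\ word_eval (tau a) = letter_eval a) ->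
  hyperbolic_space (realization R (cayley_graph genX)) ->
  exists C : nat, forall w : word X H, word_eval w = 1 ->
    rel_area Rel (C * size w) (of_word (flatmap tau w)).
Proof.
move=> /rel_isoperimetricP iso tauP /hyperbolic_graph_dist[K hyp].
have tau_eval u := @flatmap_eval _ _ H X Y tau u (fun a => (tauP a).2).
have tau_size u := @flatmap_size _ _ H X Y tau u m (fun a => (tauP a).1).
(* s and s' have at most 2K letters each, and [tau] stretches by at most m. *)
pose C := f (m * (4 * K))%N; exists C => w.
have [n] := ubnP (size w); elim: n w => [//|n IH] w wn w1.
have [->|w0] := eqVneq w [::]; first exact: rel_area1.
have [a [s [b [s' [wE sK s's s'E]]]]] := shortcut hyp (elimN eqP w0) w1.
have {}IH : rel_area Rel (C * size (a ++ s' ++ b)) (of_word (flatmap tau (a ++ s' ++ b))).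
  apply: IH; last by rewrite -w1 wE !word_eval_cat s'E.
  by move: wn; rewrite wE !size_cat; lia.
have sA : rel_area Rel C (of_word (flatmap tau s ++ word_inv (flatmap tau s'))).
  apply: iso; last by rewrite word_eval_cat word_eval_inv !tau_eval s'E mulgV.
  rewrite size_cat size_word_inv.
  by have := tau_size s; have := tau_size s'; nia.
have := rel_areaM (rel_areaJ (of_word (flatmap tau a)) sA) IH.
rewrite of_word_cat of_word_inv wE !flatmap_cat !of_word_cat !mulgA.
rewrite mulgVK mulgVK => h; apply: rel_areaW h.
by rewrite !size_cat; nia.
Qed.

Lemma hyperbolic_linear_area (Y : set G) (Rel : set (word Y H)) (f : nat -> nat) :
  finite_set X -> finite_set Y -> rel_generating Y H ->
  rel_isoperimetric Rel f ->
  hyperbolic_space (realization R (cayley_graph genX)) ->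
  exists C : nat, rel_isoperimetric Rel (fun n => C * n)%N.
Proof.
move=> finX finY genY iso hyp.
have [m [tau tauP]] := letter_translation finX genY.
have [l [sigma sigmaP]] := letter_translation finY genX.
have [C areaC] := flatmap_area iso tauP hyp.
have tau_eval u := @flatmap_eval _ _ H X Y tau u (fun a => (tauP a).2).
have sigma_eval u := @flatmap_eval _ _ H Y X sigma u (fun a => (sigmaP a).2).
have tau_size u := @flatmap_size _ _ H X Y tau u m (fun a => (tauP a).1).
have sigma_size u := @flatmap_size _ _ H Y X sigma u l (fun a => (sigmaP a).1).
move/rel_isoperimetricP: iso => iso.
pose A := f (1 + m * l)%N; pose ts w := flatmap tau (flatmap sigma w).
(* Translating to X and back changes w by a product of conjugates of one bounded loop per letter,
   each of area at most A. *)
have back w : rel_area Rel (A * size w) (of_word w * (of_word (ts w))^-1).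
  elim: w => [|a w IH]; first by rewrite /ts /= mulgV; exact: rel_area1.
  have aA : rel_area Rel A (of_word ([:: a] ++ word_inv (flatmap tau (sigma a)))).
    apply: iso.
      rewrite size_cat size_word_inv /= leq_add2l.
      apply: leq_trans (tau_size _) _.
      by rewrite leq_mul2l (sigmaP a).1 orbT.
    rewrite word_eval_cat word_eval_inv tau_eval (sigmaP a).2.
    by rewrite /word_eval big_seq1 mulgV.
  have := rel_areaM (rel_areaJ (of_word [:: a]) IH) aA.
  rewrite of_word_cat of_word_inv -(cat1s a w) /ts (flatmap_cat sigma).
  rewrite [flatmap sigma [:: a]]/flatmap /= cats0 (flatmap_cat tau) !of_word_cat invgM.
  rewrite -(cat1s a w) of_word_cat -/(ts w) !mulgA mulgVK => h; apply: rel_areaW h.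
  by rewrite /= mulnS addnC.
exists (C * l + A)%N; apply/rel_isoperimetricP => n w wn w1.
have := rel_areaM (back w) (areaC (flatmap sigma w) _).
rewrite sigma_eval => /(_ w1); rewrite mulgVK => h; apply: rel_areaW h.
rewrite mulnDl addnC -mulnA leq_add ?leq_mul //.
by apply: leq_trans (sigma_size w) _; rewrite leq_mul.
Qed.

End hyperbolic_to_dehn.

(** * Integrals over words *)

Section discrete_form.
Context {R : realType} {G : groupType} {L : Type} {H : L -> groupClosed G}.
Context {X : set G} (u v : G -> R).
Local Open Scope ring_scope.
Implicit Types (g : G) (a : letter X H) (w : word X H).

(** [xget] picks from the coset as a set, so the value depends on g H_l alone; the coset contains g,
    so the default is never reached. *)
Definition coset_rep (l : L) g : G :=
  xget 1%g [set x | (g^-1 * x)%g \in H l].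

Lemma coset_repP l g : (g^-1 * coset_rep l g)%g \in H l.
Proof.
have /= := @xgetI _ 1%g [set x | (g^-1 * x)%g \in H l] g.
by rewrite mulVg gpred1; apply.
Qed.

Lemma coset_rep_mul l g h : h \in H l -> coset_rep l (g * h)%g = coset_rep l g.
Proof.
move=> hH; congr xget; apply/seteqP.
by split => x /=; rewrite invgM -mulgA (@gpredMl _ _ h^-1%g) ?gpredV.
Qed.

(* The factor u of the form u dv on the edge labelled a starting at g. It is
   constant on each coset of H l, which makes the form exact there. *)
Definition edge_base g a : G :=
  match a with
  | Gen x b => if b then g else (g * (val x)^-1)%g
  | Par l h => coset_rep l g
  end.

Definition letter_form g a : R :=
  u (edge_base g a) * (v (g * letter_eval a)%g - v g).

Fixpoint word_form g w : R :=
  if w is a :: w' then letter_form g a + word_form (g * letter_eval a)%g w'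
  else 0.

Lemma word_form_cat g w w' :
  word_form g (w ++ w') = word_form g w + word_form (g * word_eval w)%g w'.
Proof.
elim: w g => [|a w IH] g /=; first by rewrite word_eval_nil mulg1 add0r.
by rewrite IH word_eval_cons mulgA addrA.
Qed.

(** A letter x and its inverse use the same base point, so backtracking cancels; inside a coset of
    H_l the factor u is constant and the differences of v telescope. *)
Lemma word_form_equiv g w w' : word_equiv w w' -> word_form g w = word_form g w'.
Proof.
move=> ww'; elim: ww' g => {w w'} [//|w w' _ IH|w w' w2 _ IH _ IH2|w w' r s rs] g.
- by rewrite IH.
- by rewrite IH IH2.
have rsE : word_eval r = word_eval s.
  by have := word_eval_equiv (@word_equiv_rule _ _ _ _ [::] [::] _ _ rs); rewrite !cats0.
rewrite !word_form_cat rsE; congr (_ + (_ + _)).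
have parH l (h : nontrivial H l) : val h \in H l by have /andP[] := valP h.
move: (g * word_eval w)%g => {}g.
case: rs {rsE} => [x b|l h k hk|l h k m hk] /=; rewrite /letter_form /= !addr0.
- case: b => /=; first by rewrite mulgK -mulrDr; ring.
  by rewrite mulgVK; ring.
- rewrite (coset_rep_mul g (parH l h)) -(mulgA g) hk mulg1; ring.
- rewrite (coset_rep_mul g (parH l h)) -(mulgA g) hk; ring.
Qed.

Definition free_form g (f : free_prod X H) : R := word_form g (repr f).

Lemma free_form_word g w : free_form g (of_word w) = word_form g w.
Proof. exact/word_form_equiv/word_equiv_repr. Qed.

Lemma free_formM g f f' :
  free_form g (f * f')%g = free_form g f + free_form (g * free_eps f)%g f'.
Proof.
have [w ->] := of_word_surj f; have [w' ->] := of_word_surj f'.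
by rewrite -of_word_cat !free_form_word word_form_cat free_epsE.
Qed.

Lemma free_eps1 : free_eps (1 : free_prod X H)%g = 1%g.
Proof. by rewrite -[1%g]of_word_nil free_epsE word_eval_nil. Qed.

Lemma free_epsV f : free_eps (f^-1 : free_prod X H)%g = ((free_eps f)^-1)%g.
Proof.
by apply: (@mulgI _ (free_eps f)); rewrite -free_epsM !mulgV free_eps1.
Qed.

Lemma free_form1 g : free_form g 1%g = 0.
Proof. by rewrite -[1%g]of_word_nil free_form_word. Qed.

(** As f evaluates to 1, the conjugator is traversed back along the same path and its integrals
    cancel, whatever its length. *)
Lemma free_formJ g c f : free_eps f = 1%g ->
  free_form g (c^-1 * f * c)%g = free_form (g * (free_eps c)^-1)%g f.
Proof.
move=> f1; rewrite !free_formM free_epsM f1 mulg1 addrAC.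
by rewrite -free_formM mulVg free_form1 add0r free_epsV.
Qed.

Section bound.
Variable k : R.
Hypotheses (k0 : 0 <= k)
  (uk : forall g a, `|u (g * letter_eval a)%g - u g| <= k)
  (vk : forall g a, `|v (g * letter_eval a)%g - v g| <= k).

(** A coset representative equals g or is one letter of H_l away from it. *)
Lemma edge_base_bound g a : `|u (edge_base g a) - u g| <= k.
Proof.
case: a => [x [|]|l h] /=; first by rewrite subrr normr0.
  exact: (uk g (Gen H x false)).
have := coset_repP l g; set x := coset_rep l g => xH.
have [x1|x1] := eqVneq (g^-1 * x)%g 1%g.
  by have -> : x = g; [rewrite -[x](mulVKg g) x1 mulg1|rewrite subrr normr0].
have xP : ((g^-1 * x)%g \in H l) && ((g^-1 * x)%g != 1%g) by rewrite xH.
have := uk g (Par X (exist (fun y => (y \in H l) && (y != 1%g)) _ xP)).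
by rewrite /= mulVKg.
Qed.

Lemma word_form_estimate g w :
  `|word_form g w - u g * (v (g * word_eval w)%g - v g)| <=
    k ^+ 2 * (size w)%:R ^+ 2.
Proof.
have vw : forall w' g', `|v (g' * word_eval w')%g - v g'| <= k * (size w')%:R.
  elim=> [|a w' IH] g'; first by rewrite word_eval_nil mulg1 subrr normr0 mulr0.
  rewrite word_eval_cons mulgA /= -natr1 mulrDr mulr1.
  apply: le_trans (ler_distD (v (g' * letter_eval a)%g) _ _) _.
  by rewrite lerD.
elim: w g => [|a w IH] g.
  by rewrite /= word_eval_nil mulg1 !subrr mulr0 subr0 normr0 expr0n mulr0.
rewrite word_eval_cons mulgA /=; set g' := (g * letter_eval a)%g.
set e := v (g' * word_eval w)%g.
have -> : letter_form g a + word_form g' w - u g * (e - v g) =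
    (u (edge_base g a) - u g) * (v g' - v g) +
    ((word_form g' w - u g' * (e - v g')) + (u g' - u g) * (e - v g')).
  by rewrite /letter_form -/g'; ring.
apply: le_trans (ler_normD _ _) _.
have h1 : `|(u (edge_base g a) - u g) * (v g' - v g)| <= k * k.
  by rewrite normrM; apply: ler_pM => //; [exact: edge_base_bound|exact: vk].
have h2 : `|(u g' - u g) * (e - v g')| <= k * (k * (size w)%:R).
  by rewrite normrM; apply: ler_pM => //; [exact: uk|exact: vw].
have := ler_normD (word_form g' w - u g' * (e - v g')) ((u g' - u g) * (e - v g')).
have := IH g'; rewrite -/e -natr1.
have : 0 <= k * (k * (size w)%:R) by rewrite !mulr_ge0.
move: h1 h2; rewrite !expr2; set s := (size w)%:R; lra.
Qed.

(** A discrete Stokes formula: by [free_formJ] the integral is a sum of integrals around relators,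
    each a closed word of at most m letters. *)
Lemma rel_area_form_bound (Rel : set (word X H)) (m n : nat) g f :
  (forall r, Rel r -> (size r <= m)%N /\ word_eval r = 1%g) ->
  rel_area Rel n f -> `|free_form g f| <= n%:R * (k ^+ 2 * m%:R ^+ 2).
Proof.
move=> Relm [s [sn sR ->]].
apply: (@le_trans _ _ ((size s)%:R * (k ^+ 2 * m%:R ^+ 2))); last first.
  by rewrite ler_wpM2r ?ler_nat // mulr_ge0 ?exprn_ge0.
elim: s g sR {sn} => [|[c r] s IH] g sR.
  by rewrite big_nil free_form1 normr0 mul0r.
have [rm r1] := Relm r (sR (c, r) (mem_head _ _)).
have er : free_eps (of_word r) = 1%g by rewrite free_epsE.
rewrite big_cons free_formM free_formJ //= free_form_word.
rewrite -natr1 mulrDl mul1r addrC.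
apply: le_trans (ler_normD _ _) _; apply: lerD.
  by apply: IH => x xs; apply: sR; rewrite inE xs orbT.
have := word_form_estimate (g * (free_eps c)^-1)%g r.
rewrite r1 mulg1 subrr mulr0 subr0 => h; apply: le_trans h _.
by rewrite ler_wpM2l ?exprn_ge0 // lerXn2r ?nnegrE // ler_nat.
Qed.

End bound.
End discrete_form.

(** * A linear Dehn function implies hyperbolicity *)

Section dehn_to_hyperbolic.
Context {R : realType} {G : groupType} {L : Type} {H : L -> groupClosed G}.
Context {X : set G} (genX : rel_generating X H).
Local Open Scope ring_scope.
Local Notation D := (cayley_graph genX).
Local Notation M := (realization R D).

Definition base_vertex (p : M) : G := endpoint p false.

Lemma base_vertex_dist (p : M) :
  mdist p (Vertex R (base_vertex p : vertex D)) <= 1.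
Proof.
apply: le_trans (endpoint_mdist_le _ _) _; case: p => [v|e t] //=.
by have /andP[_ /ltW] := valP t.
Qed.

(** Each point is moved to its base vertex. The [hook] terms record this displacement; they
    telescope along the path and cancel on a loop. *)
Lemma line_sum_word_form (Y : set G) (u v : M -> R) (m : nat)
    (tau : letter X H -> word Y H) (k : R) : 0 <= k ->
  (forall a, (size (tau a) <= m)%N /\ word_eval (tau a) = letter_eval a) ->
  lipschitz1 u -> lipschitz1 v ->
  let u' (g : G) := u (Vertex R (g : vertex D)) in
  let v' (g : G) := v (Vertex R (g : vertex D)) in
  (forall g (a : letter Y H), `|u' (g * letter_eval a)%g - u' g| <= k) ->
  (forall g (a : letter Y H), `|v' (g * letter_eval a)%g - v' g| <= k) ->
  let hook p := u p * (v' (base_vertex p) - v p) in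
  forall n p q J, line_sum u v n p q J ->
  exists w : word Y H, [/\ (size w <= m * 3 * n)%N,
    (base_vertex p * word_eval w)%g = base_vertex q &
    `|J - word_form u' v' (base_vertex p) w - hook p + hook q| <=
      (4 + k ^+ 2 * (m * 3)%:R ^+ 2) * n%:R].
Proof.
move=> k0 tauP ul vl u' v' uk vk hook n p q J.
elim=> {n p q J} [p|n p q r J pq _ [w [wn pw wJ]]].
  exists [::]; split => //; first by rewrite word_eval_nil mulg1.
  by rewrite /= !subr0 add0r addNr normr0 mulr0.
pose a := base_vertex p; pose b := base_vertex q.
have pa := base_vertex_dist p; have qb := base_vertex_dist q.
(* One jump of length at most 1 and two displacements of length at most 1. *)
have ab : mdist (Vertex R (a : vertex D)) (Vertex R (b : vertex D)) <= 3%:R.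
  have := metric_triangle (Vertex R (a : vertex D)) p (Vertex R (b : vertex D)).
  have := metric_triangle p q (Vertex R (b : vertex D)).
  by rewrite (metric_sym _ p) -/a -/b in pa qb *; lra.
have [s sE asb] := walk_word (graph_dist_walk (a : vertex D) (b : vertex D)).
have {}sE : (size s <= 3)%N by rewrite sE -(ler_nat R) -mdist_vertex.
have tau_eval := @flatmap_eval _ _ H X Y tau s (fun a => (tauP a).2).
have tau_size := @flatmap_size _ _ H X Y tau s m (fun a => (tauP a).1).
have sz : (size (flatmap tau s) <= m * 3)%N.
  by apply: leq_trans tau_size _; rewrite leq_mul.
exists (flatmap tau s ++ w); split.
- by rewrite size_cat mulnS leq_add.
- by rewrite word_eval_cat mulgA tau_eval asb.
rewrite word_form_cat tau_eval -/a asb -/b.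
have := word_form_estimate k0 uk vk a (flatmap tau s).
rewrite tau_eval asb; set F := word_form _ _ a _ => FE.
have {}FE : `|F - u' a * (v' b - v' a)| <= k ^+ 2 * (m * 3)%:R ^+ 2.
  apply: le_trans FE _; rewrite ler_wpM2l ?exprn_ge0 //.
  by rewrite lerXn2r ?nnegrE // ler_nat.
set W := word_form _ _ b w in wJ *.
rewrite -/b in wJ.
(* Besides the inductive error and the word estimate, a jump leaves two products of increments, at
   most 1 and 3: hence the constant 4. *)
have -> : u p * (v q - v p) + J - (F + W) - hook p + hook r =
  (J - W - hook q + hook r) - (F - u' a * (v' b - v' a)) +
  ((u q - u p) * (v' b - v q) - (u' a - u p) * (v' b - v' a)).
  by rewrite /hook -/a -/b; ring.
have h1 : `|(u q - u p) * (v' b - v q)| <= 1 * 1.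
  rewrite normrM; apply: ler_pM => //.
    by apply: le_trans (ul _ _) _; rewrite metric_sym.
  by apply: le_trans (vl _ _) _; rewrite metric_sym.
have h2 : `|(u' a - u p) * (v' b - v' a)| <= 1 * 3.
  rewrite normrM; apply: ler_pM => //.
    by apply: le_trans (ul _ _) _; rewrite metric_sym.
  by apply: le_trans (vl _ _) _; rewrite metric_sym.
apply: le_trans (ler_normD _ _) _.
have t1 := ler_normB (J - W - hook q + hook r) (F - u' a * (v' b - v' a)).
have t2 := ler_normB ((u q - u p) * (v' b - v q)) ((u' a - u p) * (v' b - v' a)).
rewrite -natr1; lra.
Qed.

Lemma linear_area_line_sums (Y : set G) (Rel : set (word Y H)) (C l : nat) :
  finite_set X -> finite_set Y -> rel_generating Y H ->
  (forall r, Rel r -> (size r <= l)%N /\ word_eval r = 1%g) ->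
  rel_isoperimetric Rel (fun n => C * n)%N ->
  exists K : R, @linear_line_sums R M K.
Proof.
move=> finX finY genY RelP /rel_isoperimetricP iso.
have [m [tau tauP]] := letter_translation finX genY.
have [k [sigma sigmaP]] := letter_translation finY genX.
have k0 : 0 <= k%:R :> R by [].
pose A : R := 4 + k%:R ^+ 2 * (m * 3)%:R ^+ 2.
pose B : R := (C * (m * 3))%:R * (k%:R ^+ 2 * l%:R ^+ 2).
(* A letter over Y translates to at most k letters over X, hence moves by at most k in the graph. *)
have lip (f : M -> R) g (a : letter Y H) : lipschitz1 f ->
    `|f (Vertex R ((g * letter_eval a)%g : vertex D)) -
      f (Vertex R (g : vertex D))| <= k%:R.
  move=> /(_ _ _) fl; apply: le_trans (fl _ _) _; rewrite metric_sym mdist_vertex ler_nat.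
  have [ak <-] := sigmaP a; apply: leq_trans ak.
  exact/graph_dist_le/word_walk.
exists (A + B) => u v ul vl n p J pJ.
have [w [wn pw]] := line_sum_word_form k0 tauP ul vl (fun g a => lip u g a ul)
  (fun g a => lip v g a vl) pJ.
(* On a loop the two hooks are equal and cancel. *)
rewrite subrK => JW.
have w1 : word_eval w = 1%g by apply: (@mulgI _ (base_vertex p)); rewrite mulg1.
have := rel_area_form_bound k0 (fun g a => lip u g a ul)
  (fun g a => lip v g a vl) (base_vertex p) RelP (iso _ w wn w1).
rewrite free_form_word; move: JW; set W := word_form _ _ _ _ => JW WB.
have := ler_norm (J - W); have := ler_norm W.
have -> : (A + B) * n%:R = A * n%:R + (C * (m * 3 * n))%:R * (k%:R ^+ 2 * l%:R ^+ 2).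
  by rewrite /B !natrM; ring.
by rewrite /A; lra.
Qed.

End dehn_to_hyperbolic.

(** * The equivalence of the two conditions *)

Lemma rel_presentation_relator (G : groupType) (L : Type)
    (H : L -> groupClosed G) (X : set G) (Rel : set (word X H)) r :
  rel_presentation Rel -> Rel r -> word_eval r = 1%g.
Proof.
move=> [_ _ kerE] Rr; rewrite -free_epsE.
suff : Defs.kernel (@free_eps G L X H) (of_word r) by [].
by rewrite kerE => K _; apply; rewrite inE; exists r.
Qed.

Theorem theorem1p7 (R : realType) (G : groupType) (L : Type)
    (H : L -> groupClosed G)
    (fpG : rel_finitely_presented H)
    (wdG : rel_dehn_well_defined H)
    (X : set G) (finX : finite_set X) (genX : rel_generating X H) :
  rel_hyperbolic H <-> hyperbolic_space (realization R (cayley_graph genX)).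
Proof.
split=> [[_ [Y [Rel [[finY finRel relP] [f [iso _] [C fC]]]]]]|hyp].
  have [genY _ _] := relP.
  have [s RelE] := (finite_seqP (Rel : set (seq (letter Y H)))).1 finRel.
  pose l := (\max_(r <- s) size r)%N.
  have isoC : rel_isoperimetric Rel (fun n => C * n)%N.
    apply/rel_isoperimetricP => n w wn w1; apply: rel_areaW (fC n) _.
    exact: (rel_isoperimetricP Rel f).1 iso n w wn w1.
  have [|K lin] := @linear_area_line_sums R _ _ _ _ genX _ _ C l finX finY genY _ isoC.
    move=> r Rr; split; last exact: rel_presentation_relator Rr.
    apply: (@leq_bigmax_seq _ _ xpredT size) => //.
    by move: Rr; rewrite RelE.
  exact: linear_line_sums_hyperbolic realization_geodesic_space lin.
split=> //; have [Y [Rel [finRel [f fdehn]]]] := wdG.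
have [finY _ [genY _ _]] := finRel.
have [C isoC] := hyperbolic_linear_area finX finY genY fdehn.1 hyp.
exists Y, Rel; split=> //; exists f => //.
(* The Dehn function f is the smallest isoperimetric function, so it inherits the linear bound. *)
by exists C; exact: fdehn.2 isoC.
Qed.
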